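(* Let $n\ge3$. The set of elements $\Gamma_{[i;j]}^q$ with $1\le i\le j\le n$ is a generating set for the algebra $\mathcal A_n^q$, the subalgebra of $\mathfrak{osp}_q(1|2)^{\otimes n}$ generated by all $\Gamma_A^q$ with $A\subseteq[n]$.
   Context: Let $q$ be a nonzero complex number with $|q|\neq1$ and a fixed square root $q^{1/2}$. Notation: $[a]_q=\frac{q^a-q^{-a}}{q-q^{-1}}$, $\{X,Y\}=XY+YX$, $[n]=\{1,\dots,n\}$, $[i;j]=\{i,i+1,\dots,j\}$. Subalgebras are unital. **The algebra.** $\mathfrak{osp}_q(1|2)$ is the unital associative $\mathbb C$-algebra with generators $A_+,A_-,K,K^{-1},P$ and relations $KA_{\pm}K^{-1}=q^{\pm1/2}A_\pm$, $\{A_+,A_-\}=\frac{K^2-K^{-2}}{q^{1/2}-q^{-1/2}}$, $\{P,A_\pm\}=0$, $[P,K]=[P,K^{-1}]=0$, $KK^{-1}=K^{-1}K=1$, $P^2=1$. Tensor powers carry the standard (ungraded) componentwise product. The coproduct is the algebra morphism $\Delta$ with $\Delta(A_\pm)=A_\pm\otimes KP+K^{-1}\otimes A_\pm$, $\Delta(K)=K\otimes K$, $\Delta(P)=P\otimes P$. The Casimir element is $\Gamma^q=\left(-A_+A_-+\frac{q^{-1/2}K^2-q^{1/2}K^{-2}}{q-q^{-1}}\right)P$, which is central. **The coaction.** $\mathcal I$ is the subalgebra generated by $A_-K,A_+K,K^2P,\Gamma^q$, and $\tau:\mathcal I\to\mathfrak{osp}_q(1|2)\otimes\mathcal I$ is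 the algebra morphism with \begin{align*} \tau(A_-K)&=K^2P\otimes A_-K,\\ \tau(A_+K)&=K^{-2}P\otimes A_+K+q^{-1/2}(q-q^{-1})A_+^2P\otimes A_-K+q^{-1/2}(q^{1/2}-q^{-1/2})A_+K^{-1}P\otimes K^2P\\&\quad+q^{-1/2}(q-q^{-1})A_+K^{-1}P\otimes\Gamma^q,\\ \tau(K^2P)&=1\otimes K^2P-(q-q^{-1})A_+K\otimes A_-K,\qquad \tau(\Gamma^q)=1\otimes\Gamma^q. \end{align*} **The elements $\Gamma_A^q$.** Put $\Gamma_\emptyset^q=-[\tfrac12]_q$. For nonempty $A\subseteq[n]$ with $a=\min A$, $b=\max A$, $$\Gamma_A^q=1^{\otimes(a-1)}\otimes\left(\tau^A_{b-1,b}\cdots\tau^A_{a+1,a+2}\,\tau^A_{a,a+1}\right)(\Gamma^q)\otimes1^{\otimes(n-b)},$$ ($\tau^A_{a,a+1}$ is applied first; if $a=b$ no map is applied), where, writing $1$ also for identity maps, - $\tau^A_{k-1,k}=1^{\otimes(k-a-1)}\otimes\Delta$ if $k-1\in A$, $k\in A$; - $\tau^A_{k-1,k}=(1^{\otimes(k-a)}\otimes\tau)(1^{\otimes(k-a-1)}\otimes\Delta)$ if $k-1\in A$, $k\notin A$; - $\tau^A_{k-1,k}=1^{\otimes(k-a-1)}\otimes\Delta\otimes1$ if $k-1\notin A$, $k\notin A$; - $\tau^A_{k-1,k}=\mathrm{id}$ if $k-1\notin A$, $k\in A$. *)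

(* Defs.v *)
From HB Require Import structures.
From mathcomp Require Import all_boot all_order all_algebra.
From mathcomp Require Import boolp classical_sets.

Set Implicit Arguments.
Unset Strict Implicit.
Unset Printing Implicit Defensive.

Import GRing.Theory.
Local Open Scope ring_scope.
Local Open Scope quotient_scope.

Section Presentation.
Variables (F : fieldType) (X : Type).

Inductive expr : Type :=
| EGen of X
| EZero
| EOne
| EAdd of expr & expr
| EMul of expr & expr
| EScale of F & expr.

HB.instance Definition _ := gen_eqMixin expr.
HB.instance Definition _ := gen_choiceMixin expr.

Variable rels : expr -> expr -> Prop.

(* The least congruence containing [rels] for which the quotient is a unital
   associative F-algebra (opposites are obtained by scaling with -1). *)
Inductive pres_eq : expr -> expr -> Prop :=
| pres_rel x y : rels x y -> pres_eq x y
| pres_refl x : pres_eq x x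
| pres_sym x y : pres_eq x y -> pres_eq y x
| pres_trans x y z : pres_eq x y -> pres_eq y z -> pres_eq x z
| pres_add x x' y y' :
    pres_eq x x' -> pres_eq y y' -> pres_eq (EAdd x y) (EAdd x' y')
| pres_mul x x' y y' :
    pres_eq x x' -> pres_eq y y' -> pres_eq (EMul x y) (EMul x' y')
| pres_scale a x x' : pres_eq x x' -> pres_eq (EScale a x) (EScale a x')
| pres_addA x y z : pres_eq (EAdd x (EAdd y z)) (EAdd (EAdd x y) z)
| pres_addC x y : pres_eq (EAdd x y) (EAdd y x)
| pres_add0 x : pres_eq (EAdd EZero x) x
| pres_scaleA a b x : pres_eq (EScale a (EScale b x)) (EScale (a * b) x)
| pres_scale0 x : pres_eq (EScale 0 x) EZero
| pres_scale1 x : pres_eq (EScale 1 x) x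
| pres_scaleDr a x y :
    pres_eq (EScale a (EAdd x y)) (EAdd (EScale a x) (EScale a y))
| pres_scaleDl a b x :
    pres_eq (EScale (a + b) x) (EAdd (EScale a x) (EScale b x))
| pres_mulA x y z : pres_eq (EMul x (EMul y z)) (EMul (EMul x y) z)
| pres_mul1l x : pres_eq (EMul EOne x) x
| pres_mul1r x : pres_eq (EMul x EOne) x
| pres_mulDl x y z : pres_eq (EMul (EAdd x y) z) (EAdd (EMul x z) (EMul y z))
| pres_mulDr x y z : pres_eq (EMul x (EAdd y z)) (EAdd (EMul x y) (EMul x z))
| pres_scaleAl a x y : pres_eq (EScale a (EMul x y)) (EMul (EScale a x) y)
| pres_scaleAr a x y : pres_eq (EScale a (EMul x y)) (EMul x (EScale a y)).

Definition pres_eqb : rel expr := fun x y => `[< pres_eq x y >].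

Lemma pres_eqb_refl : reflexive pres_eqb.
Proof. by move=> x; apply/asboolP; exact: pres_refl. Qed.

Lemma pres_eqb_sym : symmetric pres_eqb.
Proof. by move=> x y; apply/asboolP/asboolP; exact: pres_sym. Qed.

Lemma pres_eqb_trans : transitive pres_eqb.
Proof.
by move=> y x z /asboolP xy /asboolP yz; apply/asboolP; exact: pres_trans yz.
Qed.

Canonical pres_equiv := EquivRel pres_eqb pres_eqb_refl pres_eqb_sym
  pres_eqb_trans.

Definition pres := {eq_quot pres_equiv}.
HB.instance Definition _ := Choice.on pres.

Definition pres_cls (x : expr) : pres := \pi_{eq_quot pres_equiv} x.

Lemma pres_clsP x y : pres_eq x y <-> pres_cls x = pres_cls y.
Proof.
split=> [xy|/eqmodP /asboolP //]; apply/eqmodP; exact/asboolP.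
Qed.

Lemma pres_reprK (u : pres) : pres_cls (repr u) = u.
Proof. exact: reprK. Qed.

Lemma pres_repr_cls x : pres_eq (repr (pres_cls x)) x.
Proof. by apply/pres_clsP; rewrite pres_reprK. Qed.

Definition pgen (x : X) : pres := pres_cls (EGen x).
Definition pzero : pres := pres_cls EZero.
Definition pone : pres := pres_cls EOne.
Definition padd (u v : pres) : pres := pres_cls (EAdd (repr u) (repr v)).
Definition pmul (u v : pres) : pres := pres_cls (EMul (repr u) (repr v)).
Definition pscale a (u : pres) : pres := pres_cls (EScale a (repr u)).
Definition popp : pres -> pres := pscale (-1).

Lemma pres_ind (P : pres -> Prop) :
  (forall x, P (pres_cls x)) -> forall u, P u.
Proof. by move=> H u; rewrite -(pres_reprK u). Qed.

Lemma padd_cls x y : padd (pres_cls x) (pres_cls y) = pres_cls (EAdd x y).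
Proof. by apply/pres_clsP/pres_add; exact: pres_repr_cls. Qed.

Lemma pmul_cls x y : pmul (pres_cls x) (pres_cls y) = pres_cls (EMul x y).
Proof. by apply/pres_clsP/pres_mul; exact: pres_repr_cls. Qed.

Lemma pscale_cls a x : pscale a (pres_cls x) = pres_cls (EScale a x).
Proof. by apply/pres_clsP/pres_scale; exact: pres_repr_cls. Qed.

Let pE := (padd_cls, pmul_cls, pscale_cls).

Lemma paddA : associative padd.
Proof.
by elim/pres_ind=> x; elim/pres_ind=> y; elim/pres_ind=> z; rewrite !pE;
  apply/pres_clsP; constructor.
Qed.

Lemma paddC : commutative padd.
Proof.
by elim/pres_ind=> x; elim/pres_ind=> y; rewrite !pE; apply/pres_clsP;
  constructor.
Qed.

Lemma padd0 : left_id pzero padd.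
Proof. by elim/pres_ind=> x; rewrite !pE; apply/pres_clsP; constructor. Qed.

Lemma pscaleDl u : {morph pscale^~ u : a b / a + b >-> padd a b}.
Proof.
by move=> a b; elim/pres_ind: u => x; rewrite !pE; apply/pres_clsP;
  constructor.
Qed.

Lemma pscale1 : left_id 1 pscale.
Proof. by elim/pres_ind=> x; rewrite !pE; apply/pres_clsP; constructor. Qed.

Lemma pscale0 u : pscale 0 u = pzero.
Proof. by elim/pres_ind: u => x; rewrite !pE; apply/pres_clsP; constructor. Qed.

Lemma paddN : left_inverse pzero popp padd.
Proof.
by move=> u; rewrite -{2}[u]pscale1 -pscaleDl addNr pscale0.
Qed.

HB.instance Definition _ := GRing.isZmodule.Build pres paddA paddC padd0 paddN.

Lemma pscaleA a b u : pscale a (pscale b u) = pscale (a * b) u.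
Proof. by elim/pres_ind: u => x; rewrite !pE; apply/pres_clsP; constructor. Qed.

Lemma pscaleDr : right_distributive pscale +%R.
Proof.
by move=> a; elim/pres_ind=> x; elim/pres_ind=> y;
  rewrite /GRing.add /= !pE; apply/pres_clsP; constructor.
Qed.

HB.instance Definition _ := GRing.Zmodule_isLmodule.Build F pres
  pscaleA pscale1 pscaleDr pscaleDl.

Lemma pmulA : associative pmul.
Proof.
by elim/pres_ind=> x; elim/pres_ind=> y; elim/pres_ind=> z; rewrite !pE;
  apply/pres_clsP; constructor.
Qed.

Lemma pmul1l : left_id pone pmul.
Proof. by elim/pres_ind=> x; rewrite !pE; apply/pres_clsP; constructor. Qed.

Lemma pmul1r : right_id pone pmul.
Proof. by elim/pres_ind=> x; rewrite !pE; apply/pres_clsP; constructor. Qed.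

Lemma pmulDl : left_distributive pmul +%R.
Proof.
by elim/pres_ind=> x; elim/pres_ind=> y; elim/pres_ind=> z;
  rewrite /GRing.add /= !pE; apply/pres_clsP; constructor.
Qed.

Lemma pmulDr : right_distributive pmul +%R.
Proof.
by elim/pres_ind=> x; elim/pres_ind=> y; elim/pres_ind=> z;
  rewrite /GRing.add /= !pE; apply/pres_clsP; constructor.
Qed.

HB.instance Definition _ := GRing.Zmodule_isPzRing.Build pres
  pmulA pmul1l pmul1r pmulDl pmulDr.

Lemma pscaleAl a (u v : pres) : a *: (u * v) = (a *: u) * v.
Proof.
elim/pres_ind: u => x; elim/pres_ind: v => y.
by rewrite /GRing.scale /GRing.mul /= !pE; apply/pres_clsP; constructor.
Qed.

Lemma pscaleAr a (u v : pres) : a *: (u * v) = u * (a *: v).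
Proof.
elim/pres_ind: u => x; elim/pres_ind: v => y.
by rewrite /GRing.scale /GRing.mul /= !pE; apply/pres_clsP; constructor.
Qed.

Lemma pres_clsD x y : pres_cls (EAdd x y) = pres_cls x + pres_cls y.
Proof. by rewrite /GRing.add /= pE. Qed.

Lemma pres_clsM x y : pres_cls (EMul x y) = pres_cls x * pres_cls y.
Proof. by rewrite /GRing.mul /= pE. Qed.

Lemma pres_clsZ a x : pres_cls (EScale a x) = a *: pres_cls x.
Proof. by rewrite /GRing.scale /= pE. Qed.

Section Lift.
Variables (B : algType F) (g : X -> B).

Fixpoint eval (x : expr) : B :=
  match x with
  | EGen i => g i
  | EZero => 0
  | EOne => 1
  | EAdd x y => eval x + eval y
  | EMul x y => eval x * eval y
  | EScale a x => a *: eval x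
  end.

Definition plift (u : pres) : B := eval (repr u).

Hypothesis g_rel : forall x y, rels x y -> eval x = eval y.

Lemma eval_pres_eq x y : pres_eq x y -> eval x = eval y.
Proof.
elim=> //=; clear x y.
- by move=> x y z _ -> _ ->.
- by move=> x x' y y' _ -> _ ->.
- by move=> x x' y y' _ -> _ ->.
- by move=> a x x' _ ->.
- by move=> x y z; rewrite addrA.
- by move=> x y; rewrite addrC.
- by move=> x; rewrite add0r.
- by move=> a b x; rewrite scalerA.
- by move=> x; rewrite scale0r.
- by move=> x; rewrite scale1r.
- by move=> a x y; rewrite scalerDr.
- by move=> a b x; rewrite scalerDl.
- by move=> x y z; rewrite mulrA.
- by move=> x; rewrite mul1r.
- by move=> x; rewrite mulr1.
- by move=> x y z; rewrite mulrDl.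
- by move=> x y z; rewrite mulrDr.
- by move=> a x y; rewrite scalerAl.
- by move=> a x y; rewrite scalerAr.
Qed.

Lemma plift_cls x : plift (pres_cls x) = eval x.
Proof. exact/eval_pres_eq/pres_repr_cls. Qed.

Lemma plift_gen i : plift (pgen i) = g i.
Proof. exact: plift_cls. Qed.

Lemma plift_linear : linear plift.
Proof.
move=> a; elim/pres_ind=> x; elim/pres_ind=> y.
by rewrite -pres_clsZ -pres_clsD !plift_cls.
Qed.

Lemma plift_monoid : monoid_morphism plift.
Proof.
split; first exact: plift_cls EOne.
by elim/pres_ind=> x; elim/pres_ind=> y; rewrite -pres_clsM !plift_cls.
Qed.

End Lift.

End Presentation.

Section TensorModule.
Variables (F : fieldType) (A B : lmodType F).

Inductive texpr : Type :=
| TPure of A & B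
| TZero
| TAdd of texpr & texpr
| TScale of F & texpr.

HB.instance Definition _ := gen_eqMixin texpr.
HB.instance Definition _ := gen_choiceMixin texpr.

(* The least congruence making formal combinations of pairs into a vector space
   in which pairs are bilinear. *)
Inductive teq : texpr -> texpr -> Prop :=
| teq_refl x : teq x x
| teq_sym x y : teq x y -> teq y x
| teq_trans x y z : teq x y -> teq y z -> teq x z
| teq_add x x' y y' : teq x x' -> teq y y' -> teq (TAdd x y) (TAdd x' y')
| teq_scale a x x' : teq x x' -> teq (TScale a x) (TScale a x')
| teq_addA x y z : teq (TAdd x (TAdd y z)) (TAdd (TAdd x y) z)
| teq_addC x y : teq (TAdd x y) (TAdd y x)
| teq_add0 x : teq (TAdd TZero x) x
| teq_scaleA a b x : teq (TScale a (TScale b x)) (TScale (a * b) x)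
| teq_scale0 x : teq (TScale 0 x) TZero
| teq_scale1 x : teq (TScale 1 x) x
| teq_scaleDr a x y : teq (TScale a (TAdd x y)) (TAdd (TScale a x) (TScale a y))
| teq_scaleDl a b x : teq (TScale (a + b) x) (TAdd (TScale a x) (TScale b x))
| teq_pureDl u u' v : teq (TPure (u + u') v) (TAdd (TPure u v) (TPure u' v))
| teq_pureDr u v v' : teq (TPure u (v + v')) (TAdd (TPure u v) (TPure u v'))
| teq_pureZl a u v : teq (TPure (a *: u) v) (TScale a (TPure u v))
| teq_pureZr a u v : teq (TPure u (a *: v)) (TScale a (TPure u v)).

Definition teqb : rel texpr := fun x y => `[< teq x y >].

Lemma teqb_refl : reflexive teqb.
Proof. by move=> x; apply/asboolP; exact: teq_refl. Qed.

Lemma teqb_sym : symmetric teqb.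
Proof. by move=> x y; apply/asboolP/asboolP; exact: teq_sym. Qed.

Lemma teqb_trans : transitive teqb.
Proof.
by move=> y x z /asboolP xy /asboolP yz; apply/asboolP; exact: teq_trans yz.
Qed.

Canonical teq_equiv := EquivRel teqb teqb_refl teqb_sym teqb_trans.

Definition tens := {eq_quot teq_equiv}.
HB.instance Definition _ := Choice.on tens.

Definition tcls (x : texpr) : tens := \pi_{eq_quot teq_equiv} x.
Definition pure (u : A) (v : B) : tens := tcls (TPure u v).

Lemma tclsP x y : teq x y <-> tcls x = tcls y.
Proof. by split=> [xy|/eqmodP /asboolP //]; apply/eqmodP; exact/asboolP. Qed.

Lemma treprK (u : tens) : tcls (repr u) = u.
Proof. exact: reprK. Qed.

Lemma trepr_cls x : teq (repr (tcls x)) x.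
Proof. by apply/tclsP; rewrite treprK. Qed.

Lemma tcls_ind (P : tens -> Prop) : (forall x, P (tcls x)) -> forall u, P u.
Proof. by move=> H u; rewrite -(treprK u). Qed.

Definition tadd (u v : tens) : tens := tcls (TAdd (repr u) (repr v)).
Definition tscale a (u : tens) : tens := tcls (TScale a (repr u)).
Definition topp : tens -> tens := tscale (-1).

Lemma tadd_cls x y : tadd (tcls x) (tcls y) = tcls (TAdd x y).
Proof. by apply/tclsP/teq_add; exact: trepr_cls. Qed.

Lemma tscale_cls a x : tscale a (tcls x) = tcls (TScale a x).
Proof. by apply/tclsP/teq_scale; exact: trepr_cls. Qed.

Let tE := (tadd_cls, tscale_cls).

Lemma taddA : associative tadd.
Proof.
by elim/tcls_ind=> x; elim/tcls_ind=> y; elim/tcls_ind=> z; rewrite !tE;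
  apply/tclsP; constructor.
Qed.

Lemma taddC : commutative tadd.
Proof.
by elim/tcls_ind=> x; elim/tcls_ind=> y; rewrite !tE; apply/tclsP; constructor.
Qed.

Lemma tadd0 : left_id (tcls TZero) tadd.
Proof. by elim/tcls_ind=> x; rewrite !tE; apply/tclsP; constructor. Qed.

Lemma tscaleDl u : {morph tscale^~ u : a b / a + b >-> tadd a b}.
Proof.
by move=> a b; elim/tcls_ind: u => x; rewrite !tE; apply/tclsP; constructor.
Qed.

Lemma tscale1 : left_id 1 tscale.
Proof. by elim/tcls_ind=> x; rewrite !tE; apply/tclsP; constructor. Qed.

Lemma tscale0 u : tscale 0 u = tcls TZero.
Proof. by elim/tcls_ind: u => x; rewrite !tE; apply/tclsP; constructor. Qed.

Lemma taddN : left_inverse (tcls TZero) topp tadd.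
Proof. by move=> u; rewrite -{2}[u]tscale1 -tscaleDl addNr tscale0. Qed.

HB.instance Definition _ := GRing.isZmodule.Build tens taddA taddC tadd0 taddN.

Lemma tscaleA a b u : tscale a (tscale b u) = tscale (a * b) u.
Proof. by elim/tcls_ind: u => x; rewrite !tE; apply/tclsP; constructor. Qed.

Lemma tscaleDr : right_distributive tscale +%R.
Proof.
by move=> a; elim/tcls_ind=> x; elim/tcls_ind=> y;
  rewrite /GRing.add /= !tE; apply/tclsP; constructor.
Qed.

HB.instance Definition _ := GRing.Zmodule_isLmodule.Build F tens
  tscaleA tscale1 tscaleDr tscaleDl.

Lemma tclsD x y : tcls (TAdd x y) = tcls x + tcls y.
Proof. by rewrite /GRing.add /= tE. Qed.

Lemma tclsZ a x : tcls (TScale a x) = a *: tcls x.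
Proof. by rewrite /GRing.scale /= tE. Qed.

Lemma pure_bilinear : bilinear_for *:%R *:%R pure.
Proof.
split=> [v a u u'|u a v v']; rewrite /= /pure -tclsZ -tclsD; apply/tclsP.
- apply: teq_trans (teq_pureDl _ _ _) _.
  by apply: teq_add (teq_refl _); exact: teq_pureZl.
- apply: teq_trans (teq_pureDr _ _ _) _.
  by apply: teq_add (teq_refl _); exact: teq_pureZr.
Qed.

HB.instance Definition _ := bilinear_isBilinear.Build F A B tens *:%R *:%R
  pure pure_bilinear.

Lemma pureDl u u' v : pure (u + u') v = pure u v + pure u' v.
Proof. exact: linearDl. Qed.

Lemma pureDr u v v' : pure u (v + v') = pure u v + pure u v'.
Proof. exact: linearDr. Qed.

Lemma pureBl u u' v : pure (u - u') v = pure u v - pure u' v.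
Proof. exact: linearBl. Qed.

Lemma pureBr u v v' : pure u (v - v') = pure u v - pure u v'.
Proof. exact: linearBr. Qed.

Lemma pureZl a u v : pure (a *: u) v = a *: pure u v.
Proof. exact: linearZl_LR. Qed.

Lemma pureZr a u v : pure u (a *: v) = a *: pure u v.
Proof. exact: linearZr_LR. Qed.

Lemma pureNl u v : pure (- u) v = - pure u v.
Proof. exact: linearNl. Qed.

Lemma pureNr u v : pure u (- v) = - pure u v.
Proof. exact: linearNr. Qed.

Lemma pure0l v : pure 0 v = 0.
Proof. exact: linear0l. Qed.

Lemma pure0r u : pure u 0 = 0.
Proof. exact: linear0r. Qed.

Lemma tens_ind (P : tens -> Prop) :
  (forall u v, P (pure u v)) -> P 0 ->
  (forall x y, P x -> P y -> P (x + y)) ->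
  (forall a x, P x -> P (a *: x)) -> forall x, P x.
Proof.
move=> Pp P0 PD PZ; elim/tcls_ind; elim=> //=.
- by move=> x Px y Py; rewrite tclsD; exact: PD.
- by move=> a x Px; rewrite tclsZ; exact: PZ.
Qed.

Section TensorLift.
Variables (V : lmodType F) (f : {bilinear A -> B -> V}).

Fixpoint teval (x : texpr) : V :=
  match x with
  | TPure u v => f u v
  | TZero => 0
  | TAdd x y => teval x + teval y
  | TScale a x => a *: teval x
  end.

Definition tlift (x : tens) : V := teval (repr x).

Lemma teval_teq x y : teq x y -> teval x = teval y.
Proof.
elim=> //=; clear x y.
- by move=> x y z _ -> _ ->.
- by move=> x x' y y' _ -> _ ->.
- by move=> a x x' _ ->.
- by move=> x y z; rewrite addrA.
- by move=> x y; rewrite addrC.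
- by move=> x; rewrite add0r.
- by move=> a b x; rewrite scalerA.
- by move=> x; rewrite scale0r.
- by move=> x; rewrite scale1r.
- by move=> a x y; rewrite scalerDr.
- by move=> a b x; rewrite scalerDl.
- by move=> u u' v; rewrite linearDl.
- by move=> u v v'; rewrite linearDr.
- by move=> a u v; rewrite linearZl_LR.
- by move=> a u v; rewrite linearZr_LR.
Qed.

Lemma tlift_cls x : tlift (tcls x) = teval x.
Proof. exact/teval_teq/trepr_cls. Qed.

Lemma tliftE u v : tlift (pure u v) = f u v.
Proof. exact: tlift_cls. Qed.

Lemma tlift_linear : linear tlift.
Proof.
move=> a; elim/tcls_ind=> x; elim/tcls_ind=> y.
by rewrite -tclsZ -tclsD !tlift_cls.
Qed.

HB.instance Definition _ := GRing.isLinear.Build F tens V *:%R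
  tlift tlift_linear.

Lemma tlift0 : tlift 0 = 0.
Proof. exact: raddf0. Qed.

Lemma tliftD x y : tlift (x + y) = tlift x + tlift y.
Proof. exact: raddfD. Qed.

Lemma tliftZ a x : tlift (a *: x) = a *: tlift x.
Proof. exact: linearZ. Qed.

End TensorLift.

End TensorModule.

Arguments pure {F A B}.

Notation "A ⊗ B" := (tens A B) (at level 40, left associativity) : type_scope.
Notation "x '⊗p' y" := (pure x y) (at level 40, left associativity) : ring_scope.

Section Retraction.
Local Open Scope classical_set_scope.
Variables (F : fieldType) (W V : lmodType F) (i : {linear W -> V}).
Hypothesis i_inj : injective i.

Let P (S : set V) :=
  (forall a x y, S x -> S y -> S (a *: x + y)) /\ (forall w, S (i w) -> w = 0).

Lemma linear_retraction : exists r : {linear V -> W}, cancel i r.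
Proof.
have /Zorn_bigcup [S [[SL Si] Smax]] (C : set (set V)) :
    C `<=` P -> total_on C subset -> P (\bigcup_(X in C) X).
  move=> CP Ctot; split=> [a x y [X CX Xx] [Y CY Yy]|w [X CX Xw]]; last first.
    exact: (CP _ CX).2.
  have [XY|YX] := Ctot _ _ CX CY.
    by exists Y => //; apply: (CP _ CY).1 => //; exact: XY.
  by exists X => //; apply: (CP _ CX).1 => //; exact: YX.
have S0 : S 0.
  apply: contrapT => nS0; have nS x : ~ S x.
    by move=> Sx; apply: nS0; rewrite -(addNr x) -scaleN1r; exact: SL.
  apply: (Smax [set 0]).
    by split=> [x /nS//|/(_ 0 erefl)/nS].
  split=> [a x y -> ->|w /= /eqP]; first by rewrite scaler0 addr0.
  by rewrite -(raddf0 i) => /eqP /i_inj.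
have SZ a x : S x -> S (a *: x).
  by move=> Sx; rewrite -[_ *: _]addr0; exact: SL.
have SB x y : S x -> S y -> S (x - y).
  by move=> Sx Sy; rewrite addrC -scaleN1r; exact: SL.
have dec v : exists w, S (v - i w).
  apply: contrapT => nv.
  apply: (Smax [set x | exists a, S (x - a *: v)]).
    split=> [x Sx|H]; first by exists 0; rewrite scale0r subr0.
    apply: nv; exists 0; rewrite raddf0 subr0; apply: H.
    by exists 1; rewrite scale1r subrr.
  split=> [b x y [a Sa] [c Sc]|w [a Sa]].
    exists (b * a + c); rewrite scalerDl opprD addrACA -scalerA -scalerBr.
    exact: SL.
  have [a0|an0] := eqVneq a 0.
    by apply: Si; move: Sa; rewrite a0 scale0r subr0.
  exfalso; apply: nv; exists (a^-1 *: w).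
  have -> : v - i (a^-1 *: w) = - a^-1 *: (i w - a *: v).
    rewrite linearZ scaleNr scalerBr scalerA mulVf // scale1r opprB //.
  exact: SZ.
pose r v := sval (cid (dec v)).
have rP v : S (v - i (r v)) by rewrite /r; case: cid.
have uniq v w : S (v - i w) -> r v = w.
  move=> Sw; apply/eqP; rewrite -subr_eq0; apply/eqP/Si.
  have -> : i (r v - w) = (v - i w) - (v - i (r v)).
    by rewrite raddfB opprB [RHS]addrC addrA subrK.
  exact: SB.
have r_lin : linear r.
  move=> a x y; apply: uniq.
  have -> : a *: x + y - i (a *: r x + r y) =
      a *: (x - i (r x)) + (y - i (r y)).
    by rewrite linearP opprD addrACA scalerBr.
  exact: SL.
pose rM := GRing.isLinear.Build F V W *:%R r r_lin.
pose rL : {linear V -> W} := HB.pack r rM.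
by exists rL => w; apply: uniq; rewrite subrr.
Qed.

End Retraction.

Section TensorAlgebra.
Variables (F : fieldType) (A B : algType F).
Implicit Types (a : A) (b : B) (x y z : A ⊗ B).

Definition tmul2 a b : A -> B -> A ⊗ B := fun a' b' => (a * a') ⊗p (b * b').

Lemma tmul2_bilinear a b : bilinear_for *:%R *:%R (tmul2 a b).
Proof.
split=> [v c u u'|u c v v'] /=; rewrite /tmul2 mulrDr -scalerAr.
- by rewrite linearDl linearZl_LR.
- by rewrite linearDr linearZr_LR.
Qed.

HB.instance Definition _ a b := bilinear_isBilinear.Build F A B (A ⊗ B)
  *:%R *:%R (tmul2 a b) (tmul2_bilinear a b).

Definition tmul1 y : A -> B -> A ⊗ B := fun a b => tlift (tmul2 a b) y.

Lemma tmul1_bilinear y : bilinear_for *:%R *:%R (tmul1 y).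
Proof.
split=> [v c u u'|u c v v'] /=; rewrite /tmul1;
  elim/tens_ind: y => [a b||x y Hx Hy|d x Hx].
- by rewrite !tliftE /= /tmul2 mulrDl -scalerAl linearDl linearZl_LR.
- by rewrite !tlift0 scaler0 addr0.
- by rewrite !tliftD Hx Hy scalerDr addrACA.
- by rewrite !tliftZ Hx scalerDr !scalerA mulrC.
- by rewrite !tliftE /= /tmul2 mulrDl -scalerAl linearDr linearZr_LR.
- by rewrite !tlift0 scaler0 addr0.
- by rewrite !tliftD Hx Hy scalerDr addrACA.
- by rewrite !tliftZ Hx scalerDr !scalerA mulrC.
Qed.

HB.instance Definition _ y := bilinear_isBilinear.Build F A B (A ⊗ B)
  *:%R *:%R (tmul1 y) (tmul1_bilinear y).

(* [tmul] is determined by [tmulE] and bilinearity. *)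
Definition tmul x y : A ⊗ B := tlift (tmul1 y) x.

Lemma tmulE a b a' b' : tmul (a ⊗p b) (a' ⊗p b') = (a * a') ⊗p (b * b').
Proof. by rewrite /tmul tliftE /= /tmul1 tliftE. Qed.

Lemma tmul_linearl y c x x' : tmul (c *: x + x') y = c *: tmul x y + tmul x' y.
Proof. by rewrite /tmul linearP. Qed.

Lemma tmul_linearr x c y y' : tmul x (c *: y + y') = c *: tmul x y + tmul x y'.
Proof.
rewrite /tmul; elim/tens_ind: x => [a b||x x' Hx Hy|d x Hx].
- by rewrite !tliftE /= /tmul1 linearP.
- by rewrite !tlift0 scaler0 addr0.
- by rewrite !tliftD Hx Hy scalerDr addrACA.
- by rewrite !tliftZ Hx scalerDr !scalerA mulrC.
Qed.

Lemma tmulDl : left_distributive tmul +%R.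
Proof. by move=> x y z; rewrite -[x]scale1r tmul_linearl !scale1r. Qed.

Lemma tmulDr : right_distributive tmul +%R.
Proof. by move=> x y z; rewrite -[y]scale1r tmul_linearr !scale1r. Qed.

Lemma tmul0l x : tmul 0 x = 0.
Proof. by rewrite /tmul raddf0. Qed.

Lemma tmul0r x : tmul x 0 = 0.
Proof. by apply: (addrI (tmul x 0)); rewrite -tmulDr !addr0. Qed.

Lemma tmulZl c x y : c *: tmul x y = tmul (c *: x) y.
Proof. by rewrite -[c *: x]addr0 tmul_linearl tmul0l addr0. Qed.

Lemma tmulZr c x y : c *: tmul x y = tmul x (c *: y).
Proof. by rewrite -[c *: y]addr0 tmul_linearr tmul0r addr0. Qed.

Lemma tmulA : associative tmul.
Proof.
elim/tens_ind=> [a b||x x' Hx Hx'|d x Hx] y z; last 3 first.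
- by rewrite !tmul0l.
- by rewrite !tmulDl Hx Hx'.
- by rewrite -!tmulZl Hx.
elim/tens_ind: y => [a' b'||y y' Hy Hy'|d y Hy]; last 3 first.
- by rewrite tmul0r !tmul0l tmul0r.
- by rewrite !(tmulDl, tmulDr) Hy Hy'.
- by rewrite -tmulZl -!tmulZr -tmulZl Hy.
elim/tens_ind: z => [a'' b''||z z' Hz Hz'|d z Hz]; last 3 first.
- by rewrite !tmul0r.
- by rewrite !tmulDr Hz Hz'.
- by rewrite -!tmulZr Hz.
by rewrite !tmulE !mulrA.
Qed.

Lemma tmul1l : left_id (1 ⊗p 1) tmul.
Proof.
elim/tens_ind=> [a b||x x' Hx Hx'|d x Hx]; first by rewrite tmulE !mul1r.
- by rewrite tmul0r.
- by rewrite tmulDr Hx Hx'.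
- by rewrite -tmulZr Hx.
Qed.

Lemma tmul1r : right_id (1 ⊗p 1) tmul.
Proof.
elim/tens_ind=> [a b||x x' Hx Hx'|d x Hx]; first by rewrite tmulE !mulr1.
- by rewrite tmul0l.
- by rewrite tmulDl Hx Hx'.
- by rewrite -tmulZl Hx.
Qed.

End TensorAlgebra.

Section TensorNonzero.
Variable F : fieldType.

Lemma unit_functional (A : algType F) : exists f : {linear A -> F^o}, f 1 = 1.
Proof.
pose i : F^o -> A := fun c => c *: 1.
have i_lin : linear i by move=> c x y; rewrite /i scalerDl scalerA.
pose iM := GRing.isLinear.Build F F^o A *:%R i i_lin.
pose iL : {linear F^o -> A} := HB.pack i iM.
have i_inj : injective iL.
  move=> x y /eqP; rewrite -subr_eq0 -raddfB => /eqP.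
  rewrite /= /i => xy0; apply/eqP; rewrite -subr_eq0; apply/negPn/negP => n0.
  have /eqP := oner_neq0 A; apply.
  by rewrite -[1]scale1r -(mulVf n0) -scalerA xy0 scaler0.
have [r rK] := linear_retraction i_inj.
by exists r; rewrite -[RHS]rK /= /i scale1r.
Qed.

Definition tform (A B : algType F) (f : {linear A -> F^o})
    (g : {linear B -> F^o}) : A -> B -> F^o := fun a b => f a * g b.

Lemma tform_bilinear (A B : algType F) f g :
  bilinear_for *:%R *:%R (@tform A B f g).
Proof.
split=> [v c u u'|u c v v'] /=; rewrite /tform linearP.
- by rewrite mulrDl -[_ *: f u]/(c * f u) -mulrA.
- by rewrite mulrDr -[_ *: g v]/(c * g v) mulrCA.
Qed.

HB.instance Definition _ (A B : algType F) f g := bilinear_isBilinear.Build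
  F A B F^o *:%R *:%R (@tform A B f g) (tform_bilinear f g).

Lemma tone_neq0 (A B : algType F) : (1 : A) ⊗p (1 : B) != 0.
Proof.
have [f f1] := unit_functional A; have [g g1] := unit_functional B.
apply/eqP => /(congr1 (tlift (tform f g))).
by rewrite tliftE raddf0 /= /tform f1 g1 mul1r => /eqP; rewrite oner_eq0.
Qed.

End TensorNonzero.

Section TensorAlgebraInstance.
Variables (F : fieldType) (A B : algType F).

HB.instance Definition _ := GRing.Zmodule_isNzRing.Build (A ⊗ B)
  (@tmulA F A B) (@tmul1l F A B) (@tmul1r F A B) (@tmulDl F A B) (@tmulDr F A B)
  (tone_neq0 A B).
HB.instance Definition _ := GRing.Lmodule_isLalgebra.Build F (A ⊗ B)
  (@tmulZl F A B).
HB.instance Definition _ := GRing.Lalgebra_isAlgebra.Build F (A ⊗ B)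
  (@tmulZr F A B).

Lemma pureM (a a' : A) (b b' : B) :
  (a ⊗p b) * (a' ⊗p b') = (a * a') ⊗p (b * b').
Proof. exact: tmulE. Qed.

Lemma pure1 : (1 : A) ⊗p (1 : B) = 1.
Proof. by []. Qed.

End TensorAlgebraInstance.

Section TensorMap.
Variables (F : fieldType) (A A' B B' : lmodType F).
Variables (f : {linear A -> A'}) (g : {linear B -> B'}).

Definition tmap_pure : A -> B -> A' ⊗ B' := fun a b => f a ⊗p g b.

Lemma tmap_bilinear : bilinear_for *:%R *:%R tmap_pure.
Proof.
split=> [v c u u'|u c v v'] /=; rewrite /tmap_pure linearP.
- by rewrite linearDl linearZl_LR.
- by rewrite linearDr linearZr_LR.
Qed.

HB.instance Definition _ := bilinear_isBilinear.Build F A B (A' ⊗ B')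
  *:%R *:%R tmap_pure tmap_bilinear.

Definition tmap : A ⊗ B -> A' ⊗ B' := tlift tmap_pure.

HB.instance Definition _ := GRing.Linear.on tmap.

Lemma tmapE a b : tmap (a ⊗p b) = f a ⊗p g b.
Proof. exact: tliftE. Qed.

End TensorMap.

Notation "f '⊗m' g" := (tmap f g) (at level 40, left associativity) : ring_scope.

Section TensorMapAlgebra.
Variables (F : fieldType) (A A' B B' : algType F).
Variables (f : {lrmorphism A -> A'}) (g : {lrmorphism B -> B'}).

Lemma tmap_monoid : monoid_morphism (f ⊗m g).
Proof.
split; first by rewrite -!pure1 tmapE !rmorph1.
move=> x y; elim/tens_ind: x => [a b||x x' Hx Hx'|d x Hx]; last 3 first.
- by rewrite !(mul0r, raddf0).
- by rewrite mulrDl !raddfD /= Hx Hx' mulrDl.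
- by rewrite -scalerAl !linearZ /= Hx scalerAl.
elim/tens_ind: y => [a' b'||y y' Hy Hy'|d y Hy]; last 3 first.
- by rewrite !(mulr0, raddf0).
- by rewrite mulrDr !raddfD /= Hy Hy' mulrDr.
- by rewrite -scalerAr !linearZ /= Hy scalerAr.
by rewrite pureM !tmapE pureM !rmorphM.
Qed.

HB.instance Definition _ := GRing.isMonoidMorphism.Build (A ⊗ B) (A' ⊗ B')
  (f ⊗m g) tmap_monoid.

End TensorMapAlgebra.

Lemma tmap_inj (F : fieldType) (A B C : lmodType F) (i : {linear B -> C}) :
  injective i -> injective ((idfun : {linear A -> A}) ⊗m i).
Proof.
move=> /linear_retraction[r rK]; apply: (can_inj (g := idfun ⊗m r)).
elim/tens_ind=> [a b||x y Hx Hy|d x Hx]; first by rewrite !tmapE /= rK.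
- by rewrite !raddf0.
- by rewrite !raddfD /= Hx Hy.
- by rewrite !linearZ /= Hx.
Qed.

Section TensorAssoc.
Variables (F : fieldType) (A B C : lmodType F).

Definition tassoc2 (a : A) : B -> C -> A ⊗ B ⊗ C := fun b c => a ⊗p b ⊗p c.

Lemma tassoc2_bilinear a : bilinear_for *:%R *:%R (tassoc2 a).
Proof.
split=> [v c u u'|u c v v'] /=; rewrite /tassoc2.
- by rewrite linearDr linearDl linearZr_LR linearZl_LR.
- by rewrite linearDr linearZr_LR.
Qed.

HB.instance Definition _ a := bilinear_isBilinear.Build F B C (A ⊗ B ⊗ C)
  *:%R *:%R (tassoc2 a) (tassoc2_bilinear a).

Definition tassoc1 : A -> B ⊗ C -> A ⊗ B ⊗ C := fun a x => tlift (tassoc2 a) x.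

Lemma tassoc1_bilinear : bilinear_for *:%R *:%R tassoc1.
Proof.
split=> [y c u u'|u c v v'] /=; rewrite /tassoc1; last by rewrite linearP.
elim/tens_ind: y => [a b||x y Hx Hy|d x Hx].
- by rewrite !tliftE /= /tassoc2 linearDl linearZl_LR linearDl linearZl_LR.
- by rewrite !tlift0 scaler0 addr0.
- by rewrite !tliftD Hx Hy scalerDr addrACA.
- by rewrite !tliftZ Hx scalerDr !scalerA mulrC.
Qed.

HB.instance Definition _ := bilinear_isBilinear.Build F A (B ⊗ C) (A ⊗ B ⊗ C)
  *:%R *:%R tassoc1 tassoc1_bilinear.

Definition tassoc : A ⊗ (B ⊗ C) -> A ⊗ B ⊗ C := tlift tassoc1.

HB.instance Definition _ := GRing.Linear.on tassoc.

Lemma tassocE a b c : tassoc (a ⊗p (b ⊗p c)) = a ⊗p b ⊗p c.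
Proof. by rewrite /tassoc tliftE /= /tassoc1 tliftE. Qed.

End TensorAssoc.

(* A^{⊗k}, bracketed to the left, with A^{⊗0} = F. *)
Fixpoint tpow (F : fieldType) (A : algType F) (k : nat) : algType F :=
  if k is k'.+1 then tpow A k' ⊗ A else F^o.

Section Subalgebra.
Local Open Scope classical_set_scope.
Variables (F : fieldType) (A : algType F).

Definition is_subalg (B : set A) : Prop := GRing.subalg_closed (mem B).

Definition gen_subalg (G : set A) : set A := smallest is_subalg G.

Lemma is_subalgP (B : set A) : is_subalg B <->
  [/\ B 1, forall a x y, B x -> B y -> B (a *: x + y)
    & forall x y, B x -> B y -> B (x * y)].
Proof.
split=> [[B1 BL BM]|[B1 BL BM]]; split=> [|a x y|x y].
- exact: set_mem.
- by move=> Bx By; apply/set_mem/BL; exact/mem_set.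
- by move=> Bx By; apply/set_mem/BM; exact/mem_set.
- exact: mem_set.
- by move=> /set_mem Bx /set_mem By; exact/mem_set/BL.
- by move=> /set_mem Bx /set_mem By; exact/mem_set/BM.
Qed.

Lemma gen_subalg_is_subalg (G : set A) : is_subalg (gen_subalg G).
Proof.
apply/is_subalgP; split=> [|a x y Gx Gy|x y Gx Gy] B [+ GB].
- by move=> /is_subalgP[].
- by move=> BS; have [_ BL _] := (is_subalgP B).1 BS; apply: BL;
    [exact: Gx | exact: Gy].
- by move=> BS; have [_ _ BM] := (is_subalgP B).1 BS; apply: BM;
    [exact: Gx | exact: Gy].
Qed.

Variable G : set A.

Definition subalg_pred : pred A := fun x => x \in gen_subalg G.

Lemma subalg_pred_closed : GRing.subsemialg_closed subalg_pred.
Proof. exact/GRing.subalg_closed_semi/gen_subalg_is_subalg. Qed.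

HB.instance Definition _ := GRing.isSubalgClosed.Build F A subalg_pred
  subalg_pred_closed.

(* The subalgebra generated by [G], as an algebra in its own right. *)
Record subalg : Type := SubAlg { subalg_val : A; _ : subalg_pred subalg_val }.

HB.instance Definition _ := [isSub for subalg_val].
HB.instance Definition _ := [Choice of subalg by <:].
HB.instance Definition _ := [SubChoice_isSubAlgebra of subalg by <:].

Lemma subalg_gen_subproof x : G x -> subalg_pred x.
Proof. by move=> Gx; apply: mem_set; exact: sub_gen_smallest. Qed.

Definition subalg_gen x (Gx : G x) : subalg := SubAlg (subalg_gen_subproof Gx).

Definition subalg_incl : subalg -> A := val.

Lemma subalg_incl_linear : linear subalg_incl.
Proof. by move=> a x y; rewrite /subalg_incl linearP. Qed.

Lemma subalg_incl_monoid : monoid_morphism subalg_incl.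
Proof. by split=> [|x y]; rewrite /subalg_incl ?rmorph1 ?rmorphM. Qed.

HB.instance Definition _ := GRing.isLinear.Build F subalg A *:%R subalg_incl
  subalg_incl_linear.
HB.instance Definition _ := GRing.isMonoidMorphism.Build subalg A subalg_incl
  subalg_incl_monoid.


Lemma subalg_incl_inj : injective subalg_incl.
Proof. exact: val_inj. Qed.

End Subalgebra.

Inductive osp_gen : Type := gAp | gAm | gK | gKi | gP.

Section Osp.
Local Open Scope classical_set_scope.
(* [s] is the chosen square root of q. *)
Variables (F : fieldType) (s : F).
Let q : F := s ^+ 2.

Section Relations.
Local Notation "x '+e' y" := (@EAdd F osp_gen x y)
  (at level 50, left associativity).
Local Notation "x '*e' y" := (@EMul F osp_gen x y)
  (at level 40, left associativity).
Local Notation "a ':*e' x" := (@EScale F osp_gen a x) (at level 40).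
Local Notation Ap := (EGen F gAp).
Local Notation Am := (EGen F gAm).
Local Notation K := (EGen F gK).
Local Notation Ki := (EGen F gKi).
Local Notation P := (EGen F gP).
Local Notation one := (@EOne F osp_gen).
Local Notation zero := (@EZero F osp_gen).

Inductive osp_rel : expr F osp_gen -> expr F osp_gen -> Prop :=
| rel_KAp : osp_rel (K *e Ap *e Ki) (s :*e Ap)
| rel_KAm : osp_rel (K *e Am *e Ki) (s^-1 :*e Am)
| rel_ApAm : osp_rel (Ap *e Am +e Am *e Ap)
    ((s - s^-1)^-1 :*e (K *e K +e (-1) :*e (Ki *e Ki)))
| rel_PAp : osp_rel (P *e Ap +e Ap *e P) zero
| rel_PAm : osp_rel (P *e Am +e Am *e P) zero
| rel_PK : osp_rel (P *e K) (K *e P)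
| rel_PKi : osp_rel (P *e Ki) (Ki *e P)
| rel_KKi : osp_rel (K *e Ki) one
| rel_KiK : osp_rel (Ki *e K) one
| rel_PP : osp_rel (P *e P) one.

End Relations.

(* What the images of A_+, A_-, K, K^-1, P must satisfy under a morphism. *)
Definition osp_relations (B : algType F) (Ap Am K Ki P : B) : Prop :=
  (K * Ap * Ki = s *: Ap /\ K * Am * Ki = s^-1 *: Am) /\
  (Ap * Am + Am * Ap = (s - s^-1)^-1 *: (K ^+ 2 - Ki ^+ 2)) /\
  (P * Ap + Ap * P = 0 /\ P * Am + Am * P = 0) /\
  (P * K = K * P /\ P * Ki = Ki * P) /\
  (K * Ki = 1 /\ Ki * K = 1 /\ P ^+ 2 = 1).

Definition osp_val (B : Type) (Ap Am K Ki P : B) (g : osp_gen) : B :=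
  match g with gAp => Ap | gAm => Am | gK => K | gKi => Ki | gP => P end.

Lemma osp_val_rel (B : algType F) (Ap Am K Ki P : B) :
  osp_relations Ap Am K Ki P ->
  forall x y, osp_rel x y ->
    eval (osp_val Ap Am K Ki P) x = eval (osp_val Ap Am K Ki P) y.
Proof.
move=> [[r1 r2] [r3 [[r4 r5] [[r6 r7] [r8 [r9 r10]]]]]] x y [] //=.
by rewrite r3 scaleN1r !expr2.
Qed.

Definition osp : Type := pres osp_rel.

HB.instance Definition _ := GRing.PzRing.on osp.
HB.instance Definition _ := GRing.Lmodule.on osp.

Lemma trivial_osp_relations : @osp_relations F^o 0 0 1 1 1.
Proof.
by rewrite /osp_relations !(mul0r, mulr0, mulr1, mul1r, addr0, scaler0,
  expr1n, subrr).
Qed.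

Lemma osp_oner_neq0 : (1 : osp) != 0.
Proof.
pose g : osp_gen -> F^o := osp_val 0 0 1 1 1.
have gr := osp_val_rel trivial_osp_relations.
apply/eqP => /(congr1 (plift g)).
rewrite (plift_monoid gr).1 (plift_cls gr (EZero F osp_gen)) => /eqP.
by rewrite oner_eq0.
Qed.

HB.instance Definition _ := GRing.PzSemiRing_isNonZero.Build osp osp_oner_neq0.
HB.instance Definition _ := GRing.Lmodule_isLalgebra.Build F osp
  (@pscaleAl F osp_gen osp_rel).
HB.instance Definition _ := GRing.Lalgebra_isAlgebra.Build F osp
  (@pscaleAr F osp_gen osp_rel).

Definition ospAp : osp := pgen osp_rel gAp.
Definition ospAm : osp := pgen osp_rel gAm.
Definition ospK : osp := pgen osp_rel gK.
Definition ospKi : osp := pgen osp_rel gKi.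
Definition ospP : osp := pgen osp_rel gP.

Local Notation Ap := ospAp.
Local Notation Am := ospAm.
Local Notation K := ospK.
Local Notation Ki := ospKi.
Local Notation P := ospP.

Lemma osp_relationsP : osp_relations Ap Am K Ki P.
Proof.
have e (x y : expr F osp_gen) (u v : osp) : osp_rel x y ->
  pres_cls osp_rel x = u -> pres_cls osp_rel y = v -> u = v.
  by move=> xy <- <-; apply/pres_clsP; exact: pres_rel.
have pE := (@pres_clsD F _ osp_rel, @pres_clsM F _ osp_rel,
  @pres_clsZ F _ osp_rel).
refine (conj (conj _ _) (conj _ (conj (conj _ _) (conj (conj _ _)
  (conj _ (conj _ _)))))); [apply: e rel_KAp _ _ | apply: e rel_KAm _ _ |
  apply: e rel_ApAm _ _ | apply: e rel_PAp _ _ | apply: e rel_PAm _ _ |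
  apply: e rel_PK _ _ | apply: e rel_PKi _ _ | apply: e rel_KKi _ _ |
  apply: e rel_KiK _ _ | apply: e rel_PP _ _];
  by rewrite ?pE ?expr2 -?scaleN1r.
Qed.

Lemma osp_KKi : K * Ki = 1. Proof. by have := osp_relationsP; rewrite /osp_relations; tauto. Qed.
Lemma osp_KiK : Ki * K = 1. Proof. by have := osp_relationsP; rewrite /osp_relations; tauto. Qed.
Lemma osp_PP : P * P = 1.
Proof. by rewrite -expr2; have := osp_relationsP; rewrite /osp_relations; tauto. Qed.
Lemma osp_PK : P * K = K * P. Proof. by have := osp_relationsP; rewrite /osp_relations; tauto. Qed.
Lemma osp_PKi : P * Ki = Ki * P. Proof. by have := osp_relationsP; rewrite /osp_relations; tauto. Qed.
Lemma osp_PAp : P * Ap = - (Ap * P).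
Proof. by apply/eqP; rewrite -addr_eq0; apply/eqP; have := osp_relationsP; rewrite /osp_relations; tauto. Qed.
Lemma osp_PAm : P * Am = - (Am * P).
Proof. by apply/eqP; rewrite -addr_eq0; apply/eqP; have := osp_relationsP; rewrite /osp_relations; tauto. Qed.
Lemma osp_KApKi : K * Ap * Ki = s *: Ap.
Proof. by have := osp_relationsP; rewrite /osp_relations; tauto. Qed.
Lemma osp_KAmKi : K * Am * Ki = s^-1 *: Am.
Proof. by have := osp_relationsP; rewrite /osp_relations; tauto. Qed.
Lemma osp_ApAm : Ap * Am + Am * Ap = (s - s^-1)^-1 *: (K ^+ 2 - Ki ^+ 2).
Proof. by have := osp_relationsP; rewrite /osp_relations; tauto. Qed.

Lemma osp_KAp : K * Ap = s *: (Ap * K).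
Proof. by rewrite scalerAl -osp_KApKi -!mulrA osp_KiK mulr1. Qed.

Lemma osp_KAm : K * Am = s^-1 *: (Am * K).
Proof. by rewrite scalerAl -osp_KAmKi -!mulrA osp_KiK mulr1. Qed.

Lemma osp_ApKi : Ap * Ki = s *: (Ki * Ap).
Proof. by rewrite scalerAr -osp_KApKi !mulrA osp_KiK mul1r. Qed.

Lemma osp_AmKi : Am * Ki = s^-1 *: (Ki * Am).
Proof. by rewrite scalerAr -osp_KAmKi !mulrA osp_KiK mul1r. Qed.

(* The relations force A_+ = A_- = 0 for s = 0. *)
Lemma osp_s0 : s = 0 -> Ap = 0 /\ Am = 0.
Proof.
move=> s0; split.
- by rewrite -[Ap]mul1r -osp_KiK -mulrA osp_KAp s0 scale0r mulr0.
- by rewrite -[Am]mul1r -osp_KiK -mulrA osp_KAm s0 invr0 scale0r mulr0.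
Qed.

(* [qnum_half m] is the q-number [m/2]_q. *)
Definition qnum_half (m : int) : F := (s ^ m - s ^ (- m)) / (q - q^-1).

Definition Casimir : osp :=
  (- (Ap * Am) + (q - q^-1)^-1 *: (s^-1 *: K ^+ 2 - s *: Ki ^+ 2)) * P.

Let DAp : osp ⊗ osp := Ap ⊗p (K * P) + Ki ⊗p Ap.
Let DAm : osp ⊗ osp := Am ⊗p (K * P) + Ki ⊗p Am.
Let DK : osp ⊗ osp := K ⊗p K.
Let DKi : osp ⊗ osp := Ki ⊗p Ki.
Let DP : osp ⊗ osp := P ⊗p P.

Lemma Delta_relations : osp_relations DAp DAm DK DKi DP.
Proof.
have KPKi : K * (K * P) * Ki = K * P.
  by rewrite -!mulrA osp_PKi [K * (Ki * P)]mulrA osp_KKi mul1r.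
have KPKP : K * P * (K * P) = K ^+ 2.
  by rewrite -!mulrA [P * (K * P)]mulrA osp_PK -!mulrA osp_PP mulr1 expr2.
have PKP : P * (K * P) = K * P * P by rewrite mulrA osp_PK.
have shuffle (V : zmodType) (x y z w a1 a2 a3 a4 : V) :
    a1 + a2 = 0 -> a3 + a4 = 0 ->
    x + a1 + (a3 + y) + (z + a4 + (a2 + w)) = x + z + (y + w).
  move=> h1 h2; rewrite -[RHS]addr0 -h1 -[RHS]addr0 -h2 !addrA.
  by rewrite [LHS](ACl (1*5*4*8*2*7*3*6)).
rewrite /DAp /DAm /DK /DKi /DP.
refine (conj (conj _ _) (conj _ (conj (conj _ _) (conj (conj _ _)
  (conj _ (conj _ _)))))).
- rewrite !(mulrDl, mulrDr) !pureM KPKi osp_KKi mul1r osp_KApKi.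
  by rewrite scalerDr pureZl pureZr.
- rewrite !(mulrDl, mulrDr) !pureM KPKi osp_KKi mul1r osp_KAmKi.
  by rewrite scalerDr pureZl pureZr.
- rewrite !(mulrDl, mulrDr) !pureM KPKP.
  have cross1 : (Ap * Ki) ⊗p (K * P * Am) + (Ki * Ap) ⊗p (Am * (K * P)) = 0
      :> osp ⊗ osp.
    have [s0|sn0] := eqVneq s 0.
      have [-> ->] := osp_s0 s0.
      by rewrite !(mul0r, mulr0) !pure0l addr0.
    rewrite -[K * P * Am]mulrA osp_PAm mulrN [K * (Am * P)]mulrA osp_KAm -scalerAl.
    rewrite pureNr pureZr.
    by rewrite osp_ApKi pureZl scalerA mulVf // scale1r mulrA addNr.
  have cross2 : (Ki * Am) ⊗p (Ap * (K * P)) + (Am * Ki) ⊗p (K * P * Ap) = 0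
      :> osp ⊗ osp.
    have [s0|sn0] := eqVneq s 0.
      have [-> ->] := osp_s0 s0.
      by rewrite !(mul0r, mulr0) !pure0l addr0.
    rewrite -[K * P * Ap]mulrA osp_PAp mulrN [K * (Ap * P)]mulrA osp_KAp.
    rewrite -scalerAl pureNr pureZr.
    by rewrite osp_AmKi pureZl scalerA mulfV // scale1r mulrA addrN.
  rewrite -!expr2.
  transitivity ((Ap * Am + Am * Ap) ⊗p K ^+ 2 + Ki ^+ 2 ⊗p (Ap * Am + Am * Ap)
      : osp ⊗ osp).
    by rewrite pureDl pureDr; exact: shuffle.
  rewrite osp_ApAm !pureZl !pureZr -scalerDr; congr (_ *: _).
  rewrite pureBl pureBr addrA subrK.
  by rewrite !expr2 !pureM.
- rewrite !(mulrDl, mulrDr) !pureM PKP osp_PAp osp_PKi pureNl pureNr.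
  by rewrite addrACA !addNr addr0.
- rewrite !(mulrDl, mulrDr) !pureM PKP osp_PAm osp_PKi pureNl pureNr.
  by rewrite addrACA !addNr addr0.
- by rewrite !pureM osp_PK.
- by rewrite !pureM osp_PKi.
- by rewrite pureM osp_KKi.
- by rewrite pureM osp_KiK.
- by rewrite expr2 pureM osp_PP.
Qed.

Definition Delta : osp -> osp ⊗ osp := plift (osp_val DAp DAm DK DKi DP).

HB.instance Definition _ := GRing.isLinear.Build F osp (osp ⊗ osp) *:%R Delta
  (plift_linear (osp_val_rel Delta_relations)).
HB.instance Definition _ := GRing.isMonoidMorphism.Build osp (osp ⊗ osp) Delta
  (plift_monoid (osp_val_rel Delta_relations)).

End Osp.

Section Coideal.
Local Open Scope classical_set_scope.
Variables (F : fieldType) (s : F).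
Let q : F := s ^+ 2.
Local Notation osp := (osp s).
Local Notation Ap := (ospAp s).
Local Notation Am := (ospAm s).
Local Notation K := (ospK s).
Local Notation Ki := (ospKi s).
Local Notation P := (ospP s).

Definition coideal_gens : set osp :=
  [set Am * K; Ap * K; K ^+ 2 * P; Casimir s].

Definition coideal : Type := subalg coideal_gens.
HB.instance Definition _ := GRing.Algebra.on coideal.

Lemma coideal_gensX : coideal_gens (Am * K).
Proof. by rewrite /coideal_gens; do 3 left. Qed.
Lemma coideal_gensY : coideal_gens (Ap * K).
Proof. by rewrite /coideal_gens; do 2 left; right. Qed.
Lemma coideal_gensZ : coideal_gens (K ^+ 2 * P).
Proof. by rewrite /coideal_gens; left; right. Qed.
Lemma coideal_gensG : coideal_gens (Casimir s).
Proof. by rewrite /coideal_gens; right. Qed.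

Definition AmK : coideal := subalg_gen coideal_gensX.
Definition ApK : coideal := subalg_gen coideal_gensY.
Definition K2P : coideal := subalg_gen coideal_gensZ.
Definition CasI : coideal := subalg_gen coideal_gensG.

Definition incl : coideal -> osp := @subalg_incl F osp coideal_gens.
HB.instance Definition _ := GRing.Linear.on incl.
HB.instance Definition _ := GRing.RMorphism.on incl.

Lemma incl_inj : injective incl.
Proof. exact: subalg_incl_inj. Qed.

Local Notation "1⊗incl" := ((idfun : {lrmorphism osp -> osp}) ⊗m incl).

Lemma one_incl_inj : injective 1⊗incl.
Proof. exact/tmap_inj/incl_inj. Qed.

Lemma DeltaAp : Delta Ap = Ap ⊗p (K * P) + Ki ⊗p Ap.
Proof. exact/plift_gen/osp_val_rel/Delta_relations. Qed.
Lemma DeltaAm : Delta Am = Am ⊗p (K * P) + Ki ⊗p Am.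
Proof. exact/plift_gen/osp_val_rel/Delta_relations. Qed.
Lemma DeltaK : Delta K = K ⊗p K.
Proof. exact/plift_gen/osp_val_rel/Delta_relations. Qed.
Lemma DeltaKi : Delta Ki = Ki ⊗p Ki.
Proof. exact/plift_gen/osp_val_rel/Delta_relations. Qed.
Lemma DeltaP : Delta P = P ⊗p P.
Proof. exact/plift_gen/osp_val_rel/Delta_relations. Qed.

Lemma Delta_AmK : Delta (Am * K) = 1⊗incl ((Am * K) ⊗p K2P + 1 ⊗p AmK).
Proof.
rewrite raddfD /= !tmapE /= rmorphM /= DeltaAm DeltaK mulrDl !pureM.
by rewrite osp_KiK -[K * P * K]mulrA osp_PK mulrA -expr2.
Qed.

Lemma Delta_ApK : Delta (Ap * K) = 1⊗incl ((Ap * K) ⊗p K2P + 1 ⊗p ApK).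
Proof.
rewrite raddfD /= !tmapE /= rmorphM /= DeltaAp DeltaK mulrDl !pureM.
by rewrite osp_KiK -[K * P * K]mulrA osp_PK mulrA -expr2.
Qed.

Lemma Delta_K2P : Delta (K ^+ 2 * P) = 1⊗incl ((K ^+ 2 * P) ⊗p K2P).
Proof. by rewrite !tmapE /= rmorphM rmorphXn /= DeltaK DeltaP expr2 !pureM. Qed.

Lemma Delta_Casimir : Delta (Casimir s) = 1⊗incl (
  - ((Ap * Am * P) ⊗p K2P) + s^-1 *: ((Ap * Ki * P) ⊗p AmK)
  - (Ki * Am * P) ⊗p ApK + (Ki ^+ 2 * P) ⊗p CasI
  - (q - q^-1)^-1 *: (s^-1 *: ((Ki ^+ 2 * P) ⊗p K2P))
  + (q - q^-1)^-1 *: (s^-1 *: ((K ^+ 2 * P) ⊗p K2P))).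
Proof.
have shuffle (V : zmodType) (a1 a2 a3 b1 b2 g d1 : V) :
    - (a1 - a2 + (a3 + (b1 - b2 - g))) + (d1 - b2) =
    - a1 + a2 - a3 + g - b1 + d1.
  rewrite !opprD !opprK !addrA.
  by rewrite [LHS](ACl (1*2*3*6*4*7*5*8)) /= addrK.
have ApAmP : Ap * Am * P = (q - q^-1)^-1 *: (s^-1 *: (K ^+ 2 * P))
    - (q - q^-1)^-1 *: (s *: (Ki ^+ 2 * P)) - Casimir s.
  rewrite /Casimir mulrDl mulNr -scalerAl mulrBl -!scalerAl scalerBr.
  by rewrite opprD opprK addrCA subrr addr0.
have KPKPP : K * P * (K * P) * P = K ^+ 2 * P.
  by rewrite expr2 -!mulrA osp_PP mulr1 osp_PK.
have KPAmP : K * P * Am * P = - (s^-1 *: (Am * K)).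
  rewrite -[K * P * Am]mulrA osp_PAm mulrN mulNr -!mulrA osp_PP mulr1.
  by rewrite osp_KAm.
have ApKPP : Ap * (K * P) * P = Ap * K by rewrite -!mulrA osp_PP mulr1.
have DD u v : Delta (u + v) = Delta u + Delta v :> osp ⊗ osp by exact: raddfD.
have DN u : Delta (- u) = - Delta u :> osp ⊗ osp by exact: raddfN.
have DM u v : Delta (u * v) = Delta u * Delta v :> osp ⊗ osp.
  exact: rmorphM.
have DZ a u : Delta (a *: u) = a *: Delta u :> osp ⊗ osp by exact: linearZ.
have TD u v : 1⊗incl (u + v) = 1⊗incl u + 1⊗incl v by exact: raddfD.
have TN u : 1⊗incl (- u) = - 1⊗incl u by exact: raddfN.
have TZ a u : 1⊗incl (a *: u) = a *: 1⊗incl u by exact: linearZ.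
rewrite !(TD, TN, TZ, tmapE) /=.
rewrite /Casimir !(expr2, DD, DN, DM, DZ) DeltaAp DeltaAm DeltaK DeltaKi DeltaP.
rewrite !(mulrDl, mulrDr, mulNr) -!scalerAl !mulrBl -!scalerAl !pureM.
rewrite KPKPP KPAmP ApKPP ApAmP -!expr2.
by rewrite !(pureDr, pureNr, pureZr) scalerBr; exact: shuffle.
Qed.

Lemma Delta_coideal (x : coideal) : exists y, 1⊗incl y = Delta (incl x).
Proof.
have D_subalg : is_subalg [set u : osp | exists y, 1⊗incl y = Delta u].
  apply/is_subalgP; split=> [|a u v [y yE] [z zE]|u v [y yE] [z zE]].
  - by exists 1; rewrite !rmorph1.
  - by exists (a *: y + z); rewrite [LHS]linearP /= yE zE [RHS]linearP.
  - by exists (y * z); rewrite [LHS]rmorphM [RHS]rmorphM /= yE zE.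
have /smallest_sub := D_subalg.
move=> /(_ coideal_gens) H.
have : gen_subalg coideal_gens (incl x) by apply: set_mem; exact: valP x.
apply: H => u [[[->|->]|->]|->]; eexists; symmetry.
- exact: Delta_AmK.
- exact: Delta_ApK.
- exact: Delta_K2P.
- exact: Delta_Casimir.
Qed.

(* The corestriction I -> osp_q(1|2) ⊗ I of the coproduct. *)
Definition DeltaI (x : coideal) : osp ⊗ coideal := sval (cid (Delta_coideal x)).

Lemma DeltaIE x : 1⊗incl (DeltaI x) = Delta (incl x).
Proof. by rewrite /DeltaI; case: cid. Qed.

Lemma DeltaI_linear : linear DeltaI.
Proof.
move=> a x y; apply: one_incl_inj.
by rewrite linearP /= !DeltaIE !linearP.
Qed.

Lemma DeltaI_monoid : monoid_morphism DeltaI.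
Proof.
split=> [|x y]; apply: one_incl_inj; first by rewrite DeltaIE !rmorph1.
by rewrite rmorphM /= !DeltaIE !rmorphM.
Qed.

HB.instance Definition _ := GRing.isLinear.Build F coideal (osp ⊗ coideal)
  *:%R DeltaI DeltaI_linear.
HB.instance Definition _ := GRing.isMonoidMorphism.Build coideal
  (osp ⊗ coideal) DeltaI DeltaI_monoid.

Definition is_coaction (tau : coideal -> osp ⊗ coideal) : Prop :=
  [/\ tau AmK = (K ^+ 2 * P) ⊗p AmK,
      tau ApK = (Ki ^+ 2 * P) ⊗p ApK
        + (s^-1 * (q - q^-1)) *: ((Ap ^+ 2 * P) ⊗p AmK)
        + (s^-1 * (s - s^-1)) *: ((Ap * Ki * P) ⊗p K2P)
        + (s^-1 * (q - q^-1)) *: ((Ap * Ki * P) ⊗p CasI),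
      tau K2P = 1 ⊗p K2P - (q - q^-1) *: ((Ap * K) ⊗p AmK)
    & tau CasI = 1 ⊗p CasI].

End Coideal.

Section Gamma.
Variables (F : fieldType) (s : F).
Local Notation U := (osp s).
Local Notation I := (coideal s).

(* 1 ⊗ f, with target rebracketed to the left. *)
Definition on_last (A B C D : lmodType F) (f : {linear B -> C ⊗ D}) :
  A ⊗ B -> A ⊗ C ⊗ D := @tassoc F A C D \o (idfun ⊗m f).
HB.instance Definition _ A B C D f := GRing.Linear.on (@on_last A B C D f).

Variable tau : {lrmorphism I -> U ⊗ I}.

(* Tensor slots and the elements of A are numbered from 0. After treating
   position k the current element fills the slots 0, ..., k if k \in A, and
   0, ..., k+1 if not; in both cases its last leg is in I. *)
Definition state (in_k : bool) (k : nat) : algType F :=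
  tpow U (if in_k then k else k.+1) ⊗ I.

Definition step (in_k in_k1 : bool) (k : nat) :
    state in_k k -> state in_k1 k.+1 :=
  match in_k, in_k1 return state in_k k -> state in_k1 k.+1 with
  | true, true => on_last (DeltaI (s:=s))
  | true, false => on_last tau \o on_last (DeltaI (s:=s))
  | false, false => on_last (Delta (s:=s)) ⊗m idfun
  | false, true => idfun
  end.

Variables (n : nat) (A : {set 'I_n}).

Definition in_nat (k : nat) : bool := [exists i in A, i == k :> nat].
Definition set_min : nat := \big[Order.min/n]_(i in A) (i : nat).
Definition set_max : nat := \max_(i in A) i.

(* For min A <= k <= max A this is
   1^{⊗ min A} ⊗ (tau^A_{k-1,k} ... tau^A_{min A, min A + 1})(Casimir);
   the leading factors 1 are there from the start. *)
Fixpoint Gamma_state (k : nat) : state (in_nat k) k :=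
  match k return state (in_nat k) k with
  | 0 => 1 ⊗p CasI s
  | k'.+1 =>
      if (k'.+1 <= set_min)%N then 1 ⊗p CasI s
      else step (in_nat k'.+1) (Gamma_state k')
  end.

(* Only used for k = max A, where in_k holds. *)
Definition state_incl (in_k : bool) (k : nat) : state in_k k -> tpow U k.+1 :=
  match in_k return state in_k k -> tpow U k.+1 with
  | true => idfun ⊗m incl (s:=s)
  | false => fun=> 0
  end.

(* The value at max A + 1, followed by factors 1. *)
Fixpoint Gamma_pad (k : nat) : tpow U k :=
  match k return tpow U k with
  | 0 => 0
  | k'.+1 =>
      if k' == set_max then state_incl (Gamma_state k') else Gamma_pad k' ⊗p 1
  end.

Definition Gamma : tpow U n :=
  if A == finset.set0 then (- qnum_half s 1)%:A else Gamma_pad n.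

End Gamma.

Section HigherRank.
Local Open Scope classical_set_scope.
Variables (F : fieldType) (s : F).
Variables (tau : {lrmorphism coideal s -> osp s ⊗ coideal s}) (n : nat).

Definition interval (i j : 'I_n) : {set 'I_n} :=
  [set k : 'I_n | (i <= k <= j)%N]%SET.

(* A_n^q *)
Definition higher_rank_alg : set (tpow (osp s) n) :=
  gen_subalg [set Gamma tau A | A in [set: {set 'I_n}]].

Definition interval_Gammas : set (tpow (osp s) n) :=
  [set x | exists i j : 'I_n, (i <= j)%N /\ x = Gamma tau (interval i j)].

End HigherRank.

Arguments higher_rank_alg {F s} tau n.
Arguments interval_Gammas {F s} tau n.

(* Main.v *)
Require Import Defs.
From HB Require Import structures.
From mathcomp Require Import all_boot all_order all_algebra.
From mathcomp Require Import boolp classical_sets reals.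
From mathcomp Require Import complex ring zify.

(* Let W be the span of A_- K, A_+ K, K^2 P and Gamma in the coideal, eps the
   counit and c = q^{1/2} + q^{-1/2}. Delta, and also tau, maps W to osp ⊗ W, so
   each Gamma_A is built with its last leg in W. On W the coaction is a
   q-anticommutator,
     {w ⊗ 1, Delta Gamma}_q
       = tau w + c (Gamma ⊗ 1) Delta w + c eps(w) (1 ⊗ Gamma),
   which together with (1 ⊗ tau) tau = (Delta ⊗ 1) tau and
   (1 ⊗ eps) tau = eps(.) 1 gives, for h \notin A with h+1 \in A and
   min A < h,
     {Gamma_B, Gamma_Y}_q = Gamma_A + c Gamma_{h} Gamma_{A + h}
                            + c Gamma_{A < h} Gamma_{A > h},
   where B = (A < h) + h and Y = h + (A > h). All the other sets have fewer
   holes than A, and a set without holes is an interval. *)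

Set Implicit Arguments.
Unset Strict Implicit.
Unset Printing Implicit Defensive.

Import GRing.Theory Num.Theory.
Local Open Scope ring_scope.
Local Open Scope complex_scope.

(** Equal coefficients give equal combinations. Hiding the combination behind an abstract [L] turns
    an identity between three words into three scalar identities for [field]. *)
Lemma lincomb3 (F : fieldType) (V : lmodType F) (u v w : V) :
  exists L : F -> F -> F -> V,
  [/\ u = L 1 0 0, v = L 0 1 0 & w = L 0 0 1] /\
  [/\ forall a b c a' b' c',
        L a b c + L a' b' c' = L (a + a') (b + b') (c + c'),
      forall a b c, - L a b c = L (- a) (- b) (- c),
      forall t a b c, t *: L a b c = L (t * a) (t * b) (t * c)
    & L 0 0 0 = 0].
Proof.
exists (fun a b c => a *: u + b *: v + c *: w).
rewrite !scale0r !scale1r !addr0 !add0r; split=> //; split=> // *.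
- by rewrite !scalerDl [LHS](AC (3*3) (1*4*(2*5)*(3*6))).
- by rewrite !scaleNr !opprD.
- by rewrite !scalerDr !scalerA.
Qed.

(* [side] rewrites with the nonvanishing denominators left over by [field]. *)
Ltac by_coefficients u v w side :=
  let L := fresh "L" in let LD := fresh "LD" in let LN := fresh "LN" in
  let LZ := fresh "LZ" in let L0 := fresh "L0" in
  let Lu := fresh "Lu" in let Lv := fresh "Lv" in let Lw := fresh "Lw" in
  case: (lincomb3 u v w) => L [[Lu Lv Lw] [LD LN LZ L0]];
  rewrite ?Lu ?Lv ?Lw -?L0 ?(LD, LN, LZ); congr (L _ _ _); field;
  rewrite ?side //.

Definition q_anticomm (F : fieldType) (s : F) (A : algType F) (x y : A) : A :=
  s *: (x * y) + s^-1 *: (y * x).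

(** * Normal ordering and q-anticommutators in osp_q(1|2) *)

Section Words.
Variables (F : fieldType) (s : F).
Hypotheses (s_neq0 : s != 0) (s4_neq1 : s ^+ 4 != 1).
Let q : F := s ^+ 2.

(** Apart from s, every factor divides s^4 - 1 = (s^2 - 1)(s^2 + 1). The product is one of types, so
    the lemma serves as a list of rewriting rules, in the shapes that [field] leaves behind. *)
Lemma denominators :
  (s != 0) * (s * s * (s * s) - 1 != 0) * ((s * s) ^+ 2 - 1 != 0) *
  (s * s - 1 != 0) * (s * s + 1 != 0).
Proof.
have s4 : s * s * (s * s) - 1 != 0 by rewrite subr_eq0 -!expr2 -exprM.
have /andP[s2B s2D] : (s * s - 1 != 0) && (s * s + 1 != 0).
  by rewrite -negb_or -mulf_eq0 -subr_sqr expr1n expr2.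
by rewrite -expr2 in s4; exact: (s_neq0, s4, s4, s2B, s2D).
Qed.

(* An abstract algebra instead of [osp s] keeps the rewriting below fast. *)
Variables (U : algType F) (Ap Am K Ki P : U).
Hypotheses (PAp : P * Ap = - (Ap * P)) (PAm : P * Am = - (Am * P))
  (PK : P * K = K * P) (PKi : P * Ki = Ki * P)
  (KAp : K * Ap = s *: (Ap * K)) (KAm : K * Am = s^-1 *: (Am * K))
  (KiAp : Ki * Ap = s^-1 *: (Ap * Ki)) (KiAm : Ki * Am = s *: (Am * Ki))
  (KKi : K * Ki = 1) (KiK : Ki * K = 1) (PP : P * P = 1)
  (AmAp : Am * Ap = (s - s^-1)^-1 *: (K * K) - (s - s^-1)^-1 *: (Ki * Ki)
    - Ap * Am).

Let wordE := (PAp, PAm, PK, PKi, KAp, KAm, KiAp, KiAm, KKi, KiK, PP, AmAp).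

(** Words are bracketed to the left, so each relation u * v = w also needs a version that applies
    behind a prefix x. *)
Let mulrr (x u v w : U) : u * v = w -> x * u * v = x * w.
Proof. by move=> <-; rewrite mulrA. Qed.

Let tailE x := (mulrr x PAp, mulrr x PAm, mulrr x PK, mulrr x PKi,
  mulrr x KAp, mulrr x KAm, mulrr x KiAp, mulrr x KiAm, mulrr x KKi,
  mulrr x KiK, mulrr x PP, mulrr x AmAp).

Let linE := (@mulrDl U, @mulrDr U, @mulNr U, @mulrN U, @mulrBl U, @mulrBr U,
  @mulr1 U, @mul1r U, @mulr0 U, @mul0r U, @mulrA U, =^~ @scalerAl F U,
  =^~ @scalerAr F U, @scalerDr F U, @scalerN F U, @scalerA F U).

(* Brings every word into the form A_+^i A_-^j K^k P^l. *)
Ltac order_words := rewrite ?(expr2, linE, wordE, tailE, opprD, opprK).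

Let Cas := (- (Ap * Am) + (q - q^-1)^-1 *: (s^-1 *: K ^+ 2 - s *: Ki ^+ 2)) * P.
(** [u1], ..., [u4] are the coefficients of Delta Cas along A_- K, A_+ K, K^2 P and Cas. *)
Let u1 := s^-1 *: (Ap * Ki * P).
Let u2 := - (Ki * Am * P).
Let u3 := - (Ap * Am * P) - (q - q^-1)^-1 *: (s^-1 *: (Ki ^+ 2 * P))
  + (q - q^-1)^-1 *: (s^-1 *: (K ^+ 2 * P)).
Let u4 := Ki ^+ 2 * P.
Local Notation qanti := (q_anticomm s).
Let c := s + s^-1.

Lemma Casimir_commutes :
  [/\ Cas * Ap = Ap * Cas, Cas * Am = Am * Cas, Cas * K = K * Cas,
      Cas * Ki = Ki * Cas & Cas * P = P * Cas].
Proof.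
rewrite /Cas /q; split; order_words.
- by_coefficients (Ap * K * K * P) (Ap * Ki * Ki * P) (Ap * Ap * Am * P)
    denominators.
- by_coefficients (Am * K * K * P) (Am * Ki * Ki * P) (Ap * Am * Am * P)
    denominators.
- by_coefficients (K * K * K * P) (Ki * P) (Ap * Am * K * P) denominators.
- by_coefficients (K * P) (Ki * Ki * Ki * P) (Ap * Am * Ki * P) denominators.
- by_coefficients (K * K) (Ki * Ki) (Ap * Am) denominators.
Qed.

(** Here and in the next two lemmas, for w = A_- K, A_+ K, K^2 P, the i-th right-hand side is the
    i-th coordinate of tau w + c (Cas ⊗ 1) Delta w + c eps(w) (1 ⊗ Cas). Both sides agree after
    normal ordering. *)
Lemma qanti_AmK :
  [/\ qanti (Am * K) u1 = K ^+ 2 * P + c *: Cas, qanti (Am * K) u2 = 0,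
      qanti (Am * K) u3 = c *: (Cas * (Am * K)) & qanti (Am * K) u4 = 0].
Proof.
rewrite /Cas /q /q_anticomm /c /u1 /u2 /u3 /u4 /q; split; order_words.
- by_coefficients (K * K * P) (Ki * Ki * P) (Ap * Am * P) denominators.
- by_coefficients (Am * Am * P) (Am * Am * P) (Am * Am * P) denominators.
- by_coefficients (Am * K * K * K * P) (Am * Ki * P) (Ap * Am * Am * K * P)
    denominators.
- by_coefficients (Am * Ki * P) (Am * Ki * P) (Am * Ki * P) denominators.
Qed.

Lemma qanti_ApK :
  [/\ qanti (Ap * K) u1 = (s^-1 * (q - q^-1)) *: (Ap ^+ 2 * P),
      qanti (Ap * K) u2 = Ki ^+ 2 * P + c *: Cas,
      qanti (Ap * K) u3 =
        (s^-1 * (s - s^-1)) *: (Ap * Ki * P) + c *: (Cas * (Ap * K))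
    & qanti (Ap * K) u4 = (s^-1 * (q - q^-1)) *: (Ap * Ki * P)].
Proof.
rewrite /Cas /q /q_anticomm /c /u1 /u2 /u3 /u4 /q; split; order_words.
- by_coefficients (Ap * Ap * P) (Ap * P) (Ap * P) denominators.
- by_coefficients (K * K * P) (Ki * Ki * P) (Ap * Am * P) denominators.
- by_coefficients (Ap * K * K * K * P) (Ap * Ki * P) (Ap * Ap * Am * K * P)
    denominators.
- by_coefficients (Ap * Ki * P) (Ap * P) (Ap * P) denominators.
Qed.

Lemma qanti_K2P :
  [/\ qanti (K ^+ 2 * P) u1 = - ((q - q^-1) *: (Ap * K)),
      qanti (K ^+ 2 * P) u2 = 0,
      qanti (K ^+ 2 * P) u3 = 1 + c *: (Cas * (K ^+ 2 * P))
    & qanti (K ^+ 2 * P) u4 = c *: 1].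
Proof.
rewrite /Cas /q /q_anticomm /c /u1 /u2 /u3 /u4 /q; split; order_words.
- by_coefficients (Ap * K) (Am * K) (Am * P) denominators.
- by_coefficients (Am * K) (Am * P) (Am * P) denominators.
- by_coefficients (1 : U) (K * K * K * K) (Ap * Am * K * K) denominators.
- by_coefficients (1 : U) (Ap * P) (Am * P) denominators.
Qed.

End Words.

(** * Morphisms between tensor products, and contraction of the last leg *)

Section TensorMaps.
Variables (F : fieldType).

Lemma tassoc_monoid (A B C : algType F) : monoid_morphism (@tassoc F A B C).
Proof.
split; first by rewrite -!pure1 tassocE.
elim/tens_ind=> [a x||x x' Hx Hx'|d x Hx] y; last 3 first.
- by rewrite !(mul0r, raddf0).
- by rewrite mulrDl !raddfD /= Hx Hx' mulrDl.
- by rewrite -scalerAl !linearZ /= Hx scalerAl.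
elim/tens_ind: y => [a' x'||y y' Hy Hy'|d y Hy]; last 3 first.
- by rewrite !(mulr0, raddf0).
- by rewrite mulrDr !raddfD /= Hy Hy' mulrDr.
- by rewrite -scalerAr !linearZ /= Hy scalerAr.
rewrite pureM; elim/tens_ind: x => [b c||x y Hx Hy|d x Hx]; last 3 first.
- by rewrite !(mul0r, pure0r, raddf0).
- by rewrite mulrDl !pureDr !raddfD /= Hx Hy mulrDl.
- by rewrite -scalerAl !pureZr !linearZ /= Hx scalerAl.
elim/tens_ind: x' => [b' c'||x y Hx Hy|d x Hx]; last 3 first.
- by rewrite !(mulr0, pure0r, raddf0).
- by rewrite mulrDr !pureDr !raddfD /= Hx Hy mulrDr.
- by rewrite -scalerAr !pureZr !linearZ /= Hx scalerAr.
by rewrite pureM !tassocE !pureM.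
Qed.

HB.instance Definition _ (A B C : algType F) :=
  GRing.isMonoidMorphism.Build (A ⊗ (B ⊗ C)) (A ⊗ B ⊗ C) (@tassoc F A B C)
  (tassoc_monoid A B C).

Lemma on_last_monoid (A B C D : algType F) (f : {lrmorphism B -> C ⊗ D}) :
  monoid_morphism (@on_last F A B C D f).
Proof.
split; first by rewrite /on_last /= !rmorph1.
by move=> x y; rewrite /on_last /= !rmorphM.
Qed.

HB.instance Definition _ (A B C D : algType F) (f : {lrmorphism B -> C ⊗ D}) :=
  GRing.isMonoidMorphism.Build (A ⊗ B) (A ⊗ C ⊗ D) (@on_last F A B C D f)
  (on_last_monoid A f).

Section Contract.
Variables (A B : algType F) (e : {lrmorphism B -> F^o}).

Definition contract_pure (a : A) (b : B) : A := e b *: a.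

Lemma contract_pure_bilinear : bilinear_for *:%R *:%R contract_pure.
Proof.
split=> [v c u u'|u c v v'] /=; rewrite /contract_pure.
- by rewrite scalerDr !scalerA mulrC.
- by rewrite linearP scalerDl scalerA.
Qed.

HB.instance Definition _ := bilinear_isBilinear.Build F A B A *:%R *:%R
  contract_pure contract_pure_bilinear.

(** This is 1 ⊗ e followed by the identification of A ⊗ F with A. *)
Definition contract : A ⊗ B -> A := tlift contract_pure.

HB.instance Definition _ := GRing.Linear.on contract.

Lemma contractE a b : contract (a ⊗p b) = e b *: a.
Proof. exact: tliftE. Qed.

Lemma contract_monoid : monoid_morphism contract.
Proof.
split; first by rewrite -pure1 contractE rmorph1 scale1r.
elim/tens_ind=> [a b||x x' Hx Hx'|d x Hx] y; last 3 first.
- by rewrite !(mul0r, raddf0).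
- by rewrite mulrDl !raddfD /= Hx Hx' mulrDl.
- by rewrite -scalerAl !linearZ /= Hx scalerAl.
elim/tens_ind: y => [a' b'||y y' Hy Hy'|d y Hy]; last 3 first.
- by rewrite !(mulr0, raddf0).
- by rewrite mulrDr !raddfD /= Hy Hy' mulrDr.
- by rewrite -scalerAr !linearZ /= Hy scalerAr.
by rewrite pureM !contractE rmorphM -scalerAl -scalerAr scalerA.
Qed.

HB.instance Definition _ := GRing.isMonoidMorphism.Build (A ⊗ B) A contract
  contract_monoid.

End Contract.
End TensorMaps.

(** * The counit *)

Section Counit.
Variables (F : fieldType) (s : F).
Local Notation osp := (osp s).

Let counit_rel := osp_val_rel (trivial_osp_relations s).

Definition counit : osp -> F^o := plift (osp_val 0 0 1 1 1 : osp_gen -> F^o).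

HB.instance Definition _ := GRing.isLinear.Build F osp F^o *:%R counit
  (plift_linear counit_rel).
HB.instance Definition _ := GRing.isMonoidMorphism.Build osp F^o counit
  (plift_monoid counit_rel).

Lemma counitE :
  [/\ counit (ospAp s) = 0, counit (ospAm s) = 0, counit (ospK s) = 1,
      counit (ospKi s) = 1 & counit (ospP s) = 1].
Proof. by split; apply: (plift_gen counit_rel). Qed.

Definition counitI : coideal s -> F^o := counit \o incl (s:=s).
Arguments counitI : simpl never.
HB.instance Definition _ := GRing.Linear.on counitI.
HB.instance Definition _ := GRing.RMorphism.on counitI.

(** The last value equals -1/c = -[1/2]_q, the scalar attached to the empty set. *)
Lemma counitI_gens :
  [/\ counitI (AmK s) = 0, counitI (ApK s) = 0, counitI (K2P s) = 1
    & counitI (CasI s) = (s ^+ 2 - (s ^+ 2)^-1)^-1 * (s^-1 - s)].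
Proof.
have [e1 e2 e3 e4 e5] := counitE.
split; rewrite /counitI /=.
- by rewrite rmorphM /= e2 mul0r.
- by rewrite rmorphM /= e1 mul0r.
- by rewrite rmorphM rmorphXn /= e3 e5 expr1n mulr1.
- rewrite /Casimir rmorphM raddfD raddfN /= rmorphM /= e1 mul0r oppr0 add0r e5.
  rewrite mulr1 linearZ /= raddfB /= !linearZ /= !rmorphXn /= e3 e4 expr1n.
  by rewrite /GRing.scale /= mulrN !mulr1.
Qed.

End Counit.

(** * The coproduct and the coaction in coordinates on W *)

Section Coaction.
Variables (F : fieldType) (s : F).
Hypotheses (s_neq0 : s != 0) (s4_neq1 : s ^+ 4 != 1).
Local Notation q := (s ^+ 2).
Local Notation U := (osp s).
Local Notation I := (coideal s).
Local Notation Ap := (ospAp s).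
Local Notation Am := (ospAm s).
Local Notation K := (ospK s).
Local Notation Ki := (ospKi s).
Local Notation P := (ospP s).
Local Notation Cas := (Casimir s).

Lemma osp_KiAp : Ki * Ap = s^-1 *: (Ap * Ki).
Proof. by rewrite osp_ApKi scalerA mulVf // scale1r. Qed.

Lemma osp_KiAm : Ki * Am = s *: (Am * Ki).
Proof. by rewrite osp_AmKi scalerA divff // scale1r. Qed.

Lemma osp_AmAp :
  Am * Ap = (s - s^-1)^-1 *: (K * K) - (s - s^-1)^-1 *: (Ki * Ki) - Ap * Am.
Proof. by rewrite -scalerBr -!expr2 -osp_ApAm addrAC subrr add0r. Qed.

(* The components of [Delta Cas] along A_- K, A_+ K, K^2 P and Cas. *)
Definition DCas1 : U := s^-1 *: (Ap * Ki * P).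
Definition DCas2 : U := - (Ki * Am * P).
Definition DCas3 : U := - (Ap * Am * P)
  - (q - q^-1)^-1 *: (s^-1 *: (Ki ^+ 2 * P))
  + (q - q^-1)^-1 *: (s^-1 *: (K ^+ 2 * P)).
Definition DCas4 : U := Ki ^+ 2 * P.

Local Notation u1 := DCas1.
Local Notation u2 := DCas2.
Local Notation u3 := DCas3.
Local Notation u4 := DCas4.
Local Notation qanti := (q_anticomm s).
Local Notation c := (s + s^-1).

Lemma Casimir_comm :
  [/\ Cas * Ap = Ap * Cas, Cas * Am = Am * Cas, Cas * K = K * Cas,
      Cas * Ki = Ki * Cas & Cas * P = P * Cas].
Proof.
exact: (Casimir_commutes s_neq0 s4_neq1 (osp_PAp s) (osp_PAm s) (osp_PK s)
  (osp_PKi s) (osp_KAp s) (osp_KAm s) osp_KiAp osp_KiAm (osp_KKi s) (osp_KiK s)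
  (osp_PP s) osp_AmAp).
Qed.

Lemma osp_qanti_AmK :
  [/\ qanti (Am * K) DCas1 = K ^+ 2 * P + c *: Cas, qanti (Am * K) DCas2 = 0,
      qanti (Am * K) DCas3 = c *: (Cas * (Am * K)) & qanti (Am * K) DCas4 = 0].
Proof.
exact: (qanti_AmK s_neq0 s4_neq1 (osp_PAm s) (osp_PK s) (osp_KAp s) (osp_KAm s)
  osp_KiAm (osp_KKi s) (osp_KiK s) osp_AmAp).
Qed.

Lemma osp_qanti_ApK :
  [/\ qanti (Ap * K) DCas1 = (s^-1 * (q - q^-1)) *: (Ap ^+ 2 * P),
      qanti (Ap * K) DCas2 = Ki ^+ 2 * P + c *: Cas,
      qanti (Ap * K) DCas3 =
        (s^-1 * (s - s^-1)) *: (Ap * Ki * P) + c *: (Cas * (Ap * K))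
    & qanti (Ap * K) DCas4 = (s^-1 * (q - q^-1)) *: (Ap * Ki * P)].
Proof.
exact: (qanti_ApK s_neq0 s4_neq1 (osp_PAp s) (osp_PK s) (osp_KAp s) (osp_KAm s)
  osp_KiAp osp_KiAm (osp_KKi s) (osp_KiK s) osp_AmAp).
Qed.

Lemma osp_qanti_K2P :
  [/\ qanti (K ^+ 2 * P) DCas1 = - ((q - q^-1) *: (Ap * K)),
      qanti (K ^+ 2 * P) DCas2 = 0,
      qanti (K ^+ 2 * P) DCas3 = 1 + c *: (Cas * (K ^+ 2 * P))
    & qanti (K ^+ 2 * P) DCas4 = c *: 1].
Proof.
exact: (qanti_K2P s_neq0 s4_neq1 (osp_PAp s) (osp_PAm s) (osp_PK s) (osp_PKi s)
  (osp_KAp s) (osp_KAm s) osp_KiAm (osp_KKi s) (osp_KiK s) (osp_PP s)).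
Qed.

(** The Casimir element is central, so its q-anticommutators are c times products. This fits the
    pattern of the other three tables, since c eps(Cas) = -1 cancels the contribution of tau Cas = 1
    ⊗ Cas. *)
Lemma osp_qanti_Casimir :
  [/\ qanti Cas DCas1 = c *: (Cas * DCas1), qanti Cas DCas2 = c *: (Cas * DCas2),
      qanti Cas DCas3 = c *: (Cas * DCas3)
    & qanti Cas DCas4 = c *: (Cas * DCas4)].
Proof.
have qantiC u : GRing.comm Cas u -> qanti Cas u = c *: (Cas * u).
  by move=> Cu; rewrite /q_anticomm -Cu -scalerDl.
have [cAp cAm cK cKi cP] := Casimir_comm.
have cw u v w : GRing.comm Cas u -> GRing.comm Cas v -> GRing.comm Cas w ->
    GRing.comm Cas (u * v * w).
  by move=> Cu Cv Cw; apply: commrM Cw; apply: commrM.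
have cZ a u : GRing.comm Cas u -> GRing.comm Cas (a *: u).
  by move=> Cu; rewrite /GRing.comm -scalerAr -scalerAl Cu.
split; apply: qantiC.
- by apply/cZ/cw.
- by apply/commrN/cw.
- apply: commrD; first apply: commrB; first by apply/commrN/cw.
    by apply/cZ/cZ; apply: commrM cP; exact: commrX.
  by apply/cZ/cZ; apply: commrM cP; exact: commrX.
- by apply: commrM cP; exact: commrX.
Qed.

Section Legs.
Variable T : algType F.
Implicit Types (t : T) (x : T ⊗ I).

(* Coordinates on T ⊗ W, with W the span of A_- K, A_+ K, K^2 P and Cas. *)
Definition legs t1 t2 t3 t4 : T ⊗ I :=
  t1 ⊗p AmK s + t2 ⊗p ApK s + t3 ⊗p K2P s + t4 ⊗p CasI s.

Lemma legsD t1 t2 t3 t4 t1' t2' t3' t4' :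
  legs t1 t2 t3 t4 + legs t1' t2' t3' t4' =
  legs (t1 + t1') (t2 + t2') (t3 + t3') (t4 + t4').
Proof. by rewrite /legs !pureDl [LHS](AC (4*4) (1*5*(2*6)*(3*7)*(4*8))). Qed.

Lemma legsZ a t1 t2 t3 t4 :
  a *: legs t1 t2 t3 t4 = legs (a *: t1) (a *: t2) (a *: t3) (a *: t4).
Proof. by rewrite /legs !pureZl !scalerDr. Qed.

Lemma legsMl t t1 t2 t3 t4 :
  t ⊗p 1 * legs t1 t2 t3 t4 = legs (t * t1) (t * t2) (t * t3) (t * t4).
Proof. by rewrite /legs !mulrDr !pureM !mul1r. Qed.

Lemma legsMr t t1 t2 t3 t4 :
  legs t1 t2 t3 t4 * (t ⊗p 1) = legs (t1 * t) (t2 * t) (t3 * t) (t4 * t).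
Proof. by rewrite /legs !mulrDl !pureM !mulr1. Qed.

Lemma pure_CasI t : t ⊗p CasI s = legs 0 0 0 t.
Proof. by rewrite /legs !pure0l !add0r. Qed.

Lemma incl_legs t1 t2 t3 t4 :
  ((idfun : {lrmorphism T -> T}) ⊗m incl (s:=s)) (legs t1 t2 t3 t4) =
  t1 ⊗p (Am * K) + t2 ⊗p (Ap * K) + t3 ⊗p (K ^+ 2 * P) + t4 ⊗p Cas.
Proof. by rewrite !raddfD /= !tmapE. Qed.

Lemma contract_legs t1 t2 t3 t4 :
  contract (counitI (s:=s)) (legs t1 t2 t3 t4) = t3 - c^-1 *: t4.
Proof.
rewrite !raddfD /= !contractE /=.
have [-> -> -> ->] := counitI_gens s.
rewrite !scale0r !add0r scale1r -scaleNr; congr (_ + _ *: _).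
by field; rewrite !(denominators s_neq0 s4_neq1).
Qed.

End Legs.

Lemma DeltaI_gens :
  [/\ DeltaI (AmK s) = legs 1 0 (Am * K) 0, DeltaI (ApK s) = legs 0 1 (Ap * K) 0,
      DeltaI (K2P s) = legs 0 0 (K ^+ 2 * P) 0
    & DeltaI (CasI s) = legs u1 u2 u3 u4].
Proof.
(* [DeltaI] is accessible only through its image in osp ⊗ osp, where it becomes Delta. *)
split; apply: one_incl_inj; rewrite DeltaIE.
- by rewrite [LHS]Delta_AmK /legs !pure0l !addr0 addrC.
- by rewrite [LHS]Delta_ApK /legs !pure0l !addr0 add0r addrC.
- by rewrite [LHS]Delta_K2P /legs !pure0l !addr0 !add0r.
- rewrite [LHS]Delta_Casimir /legs /DCas1 /DCas2 /DCas3 /DCas4.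
  congr (tmap _ _ _).
  rewrite !(pureDl, pureNl, pureZl).
  by rewrite [LHS](ACl (2*3*(1*5*6)*4)).
Qed.

Variable tau : {lrmorphism I -> U ⊗ I}.
Hypothesis htau : is_coaction tau.

Local Notation la := (s^-1 * (q - q^-1)).
Local Notation mu := (s^-1 * (s - s^-1)).

Section OnLast.
Variable T : algType F.

Lemma on_last_pure (f : {linear I -> U ⊗ I}) (t : T) (w : I) u1 u2 u3 u4 :
  f w = legs u1 u2 u3 u4 ->
  on_last f (t ⊗p w) = legs (t ⊗p u1) (t ⊗p u2) (t ⊗p u3) (t ⊗p u4).
Proof.
move=> fw; rewrite /on_last /= tmapE /= fw /legs.
by rewrite !pureDr !raddfD /= !tassocE.
Qed.

Lemma on_last_DeltaI (t1 t2 t3 t4 : T) :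
  on_last (DeltaI (s:=s)) (legs t1 t2 t3 t4) =
  legs (t1 ⊗p 1 + t4 ⊗p u1) (t2 ⊗p 1 + t4 ⊗p u2)
    (t1 ⊗p (Am * K) + t2 ⊗p (Ap * K) + t3 ⊗p (K ^+ 2 * P) + t4 ⊗p u3)
    (t4 ⊗p u4).
Proof.
have [D1 D2 D3 D4] := DeltaI_gens.
rewrite [in LHS]/legs !raddfD /=.
rewrite (on_last_pure _ D1) (on_last_pure _ D2) (on_last_pure _ D3).
by rewrite (on_last_pure _ D4) !legsD !pure0r !addr0 !add0r.
Qed.

Lemma tau_gens :
  [/\ tau (AmK s) = legs (K ^+ 2 * P) 0 0 0,
      tau (ApK s) = legs (la *: (Ap ^+ 2 * P)) (Ki ^+ 2 * P)
        (mu *: (Ap * Ki * P)) (la *: (Ap * Ki * P)),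
      tau (K2P s) = legs (- ((q - q^-1) *: (Ap * K))) 0 1 0
    & tau (CasI s) = legs 0 0 0 1].
Proof.
case: htau => t1 t2 t3 t4; split; rewrite ?(t1, t2, t3, t4) /legs.
- by rewrite !pure0l !addr0.
- by rewrite !pureZl [_ ⊗p ApK s + _]addrC.
- by rewrite pureNl pureZl !pure0l !addr0 addrC.
- by rewrite !pure0l !add0r.
Qed.

Lemma on_last_tau (t1 t2 t3 t4 : T) :
  on_last tau (legs t1 t2 t3 t4) =
  legs (t1 ⊗p (K ^+ 2 * P) + la *: (t2 ⊗p (Ap ^+ 2 * P))
      - (q - q^-1) *: (t3 ⊗p (Ap * K)))
    (t2 ⊗p (Ki ^+ 2 * P))
    (mu *: (t2 ⊗p (Ap * Ki * P)) + t3 ⊗p 1)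
    (la *: (t2 ⊗p (Ap * Ki * P)) + t4 ⊗p 1).
Proof.
have [D1 D2 D3 D4] := tau_gens.
rewrite [in LHS]/legs !raddfD /=.
rewrite (on_last_pure _ D1) (on_last_pure _ D2) (on_last_pure _ D3).
by rewrite (on_last_pure _ D4) !legsD !pure0r !addr0 !add0r !pureNr !pureZr.
Qed.

End OnLast.

Section Relation.
Variable T : algType F.
Variables t1 t2 t3 t4 : T.
Local Notation x := (legs t1 t2 t3 t4).

(** The only surplus term comes from tau(A_+ K), along A_+ K^-1 P. Its coefficient [mu] - [la] / c
    vanishes because q - q^-1 = (s - s^-1) c. *)
Lemma contract_on_last_tau :
  contract (counitI (s:=s)) (on_last tau x) = contract (counitI (s:=s)) x ⊗p 1.
Proof.
rewrite on_last_tau !contract_legs // pureBl pureZl scalerDr scalerA.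
rewrite opprD addrACA -scalerBl.
suff -> : mu - c^-1 * la = 0.
  by rewrite scale0r add0r.
by field; rewrite !(denominators s_neq0 s4_neq1).
Qed.

(** The counit axiom on W; it comes down to u3 - c^-1 u4 = Cas. *)
Lemma contract_on_last_DeltaI :
  contract (counitI (s:=s)) (on_last (DeltaI (s:=s)) x) =
  ((idfun : {lrmorphism T -> T}) ⊗m incl (s:=s)) x.
Proof.
rewrite on_last_DeltaI contract_legs // incl_legs -addrA -pureZr -pureBr.
congr (_ + _ ⊗p _).
rewrite /DCas3 /DCas4 /Casimir mulrDl mulNr -scalerAl mulrBl -!scalerAl.
rewrite -!addrA; congr (_ + _).
rewrite scalerBr !scalerA addrC -addrA; congr (_ + _).
rewrite -opprD -scalerDl; congr (- (_ *: _)).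
by field; rewrite !(denominators s_neq0 s4_neq1).
Qed.

Lemma Delta_Ap2P :
  Delta (Ap ^+ 2 * P) = (Ap ^+ 2 * P) ⊗p (K ^+ 2 * P)
    + (Ki ^+ 2 * P) ⊗p (Ap ^+ 2 * P)
    - (s - s^-1) *: ((Ap * Ki * P) ⊗p (Ap * K)) :> U ⊗ U.
Proof.
rewrite rmorphM rmorphXn /= DeltaAp DeltaP expr2 !(mulrDl, mulrDr) !pureM.
have -> : K * P * (K * P) * P = K ^+ 2 * P.
  by rewrite expr2 -!mulrA osp_PP mulr1 osp_PK.
have -> : K * P * Ap * P = - (s *: (Ap * K)).
  by rewrite -[K * P * Ap]mulrA osp_PAp mulrN mulNr -!mulrA osp_PP mulr1 osp_KAp.
have -> : Ap * (K * P) * P = Ap * K by rewrite -!mulrA osp_PP mulr1.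
rewrite osp_KiAp -!expr2 -scalerAl pureZl pureNr pureZr.
by rewrite [in RHS]scalerBl opprB [LHS](AC (2*2) (1*4*(3*2))).
Qed.

Lemma Delta_ApKiP :
  Delta (Ap * Ki * P) = (Ap * Ki * P) ⊗p 1 + (Ki ^+ 2 * P) ⊗p (Ap * Ki * P)
    :> U ⊗ U.
Proof.
rewrite !rmorphM /= DeltaAp DeltaKi DeltaP !mulrDl !pureM expr2.
by rewrite -[K * P * Ki]mulrA osp_PKi mulrA osp_KKi mul1r osp_PP.
Qed.

Lemma Delta_Ki2P : Delta (Ki ^+ 2 * P) = (Ki ^+ 2 * P) ⊗p (Ki ^+ 2 * P) :> U ⊗ U.
Proof. by rewrite rmorphM rmorphXn /= DeltaKi DeltaP expr2 !pureM. Qed.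

(* (1 ⊗ tau) tau = (Delta ⊗ 1) tau, behind the factor T. *)
Lemma on_last_tau_tau :
  on_last tau (on_last tau x) =
  (on_last (Delta (s:=s)) ⊗m idfun) (on_last tau x).
Proof.
have LD (t : T) (u : U) (y : U ⊗ U) : Delta u = y ->
  on_last (Delta (s:=s)) (t ⊗p u) = tassoc (t ⊗p y).
  by move=> <-; rewrite /on_last /= tmapE.
have D1 : Delta (1 : U) = 1 ⊗p 1 :> U ⊗ U by rewrite rmorph1.
have DK2P : Delta (K ^+ 2 * P) = (K ^+ 2 * P) ⊗p (K ^+ 2 * P) :> U ⊗ U.
  by rewrite rmorphM rmorphXn /= DeltaK DeltaP expr2 !pureM.
have DApK : Delta (Ap * K) = (Ap * K) ⊗p (K ^+ 2 * P) + 1 ⊗p (Ap * K) :> U ⊗ U.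
  rewrite rmorphM /= DeltaAp DeltaK mulrDl !pureM.
  by rewrite osp_KiK -[K * P * K]mulrA osp_PK mulrA -expr2.
rewrite on_last_tau [LHS]on_last_tau.
rewrite {2}/legs !raddfD /= !tmapE /= !raddfD raddfN /= !linearZ /=.
rewrite (LD _ _ _ DK2P) (LD _ _ _ DApK) !(LD _ _ _ D1).
rewrite (LD _ _ _ Delta_Ap2P) (LD _ _ _ Delta_ApKiP) (LD _ _ _ Delta_Ki2P).
rewrite !(pureBr, pureDr, pureZr) !(raddfD, raddfB) /= !linearZ /=.
rewrite !tassocE /legs.
congr (_ ⊗p _ + _ ⊗p _ + _ ⊗p _ + _ ⊗p _).
- rewrite !(pureDl, pureNl, pureZl, scalerN, scalerDr, scalerA, opprD).
  (* The coefficient of A_+ K^-1 P ⊗ A_+ K is (q - q^-1) [mu] on the left and [la] (s - s^-1) on the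
     right, up to the common sign. *)
  have swap (a b d : F) : -1 * a * (b * d) = -1 * d * (b * a) by ring.
  by rewrite [in LHS]swap [LHS](AC (4*2) (1*(2*4*5)*(3*6))).
- by rewrite pureDl pureZl addrA [X in X + _]addrC.
- by rewrite pureDl pureZl addrA [X in X + _]addrC.
Qed.

(* {w ⊗ 1, Delta Cas}_q = tau w + c (Cas ⊗ 1) Delta w + c eps(w) (1 ⊗ Cas) on W,
   behind the factor T. *)
Lemma q_anticomm_legs :
  qanti (((idfun : {lrmorphism T -> T}) ⊗m incl (s:=s)) x ⊗p 1)
    (on_last (DeltaI (s:=s)) (1 ⊗p CasI s)) =
  on_last tau x + c *: ((1 ⊗p Cas) ⊗p 1 * on_last (DeltaI (s:=s)) x)
    + c *: (contract (counitI (s:=s)) x ⊗p 1 ⊗p 1 * (1 ⊗p CasI s)).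
Proof.
have [a1 a2 a3 a4] := osp_qanti_AmK.
have [b1 b2 b3 b4] := osp_qanti_ApK.
have [d1 d2 d3 d4] := osp_qanti_K2P.
have [e1 e2 e3 e4] := osp_qanti_Casimir.
have qD (y y' z : T ⊗ U) : qanti (y + y') z = qanti y z + qanti y' z.
  by rewrite /q_anticomm mulrDl mulrDr !scalerDr addrACA.
have qP (t : T) (w u v : U) : qanti w u = v -> qanti (t ⊗p w) (1 ⊗p u) = t ⊗p v.
  by move=> <-; rewrite /q_anticomm !pureM mulr1 mul1r pureDr !pureZr.
have qL (y : T ⊗ U) y1 y2 y3 y4 : qanti (y ⊗p 1) (legs y1 y2 y3 y4) =
    legs (qanti y y1) (qanti y y2) (qanti y y3) (qanti y y4).
  by rewrite /q_anticomm legsMl legsMr !legsZ legsD.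
rewrite incl_legs pure_CasI [in LHS]on_last_DeltaI !pure0l !add0r qL !qD.
rewrite (qP _ _ _ _ a1) (qP _ _ _ _ a2) (qP _ _ _ _ a3) (qP _ _ _ _ a4).
rewrite (qP _ _ _ _ b1) (qP _ _ _ _ b2) (qP _ _ _ _ b3) (qP _ _ _ _ b4).
rewrite (qP _ _ _ _ d1) (qP _ _ _ _ d2) (qP _ _ _ _ d3) (qP _ _ _ _ d4).
rewrite (qP _ _ _ _ e1) (qP _ _ _ _ e2) (qP _ _ _ _ e3) (qP _ _ _ _ e4).
rewrite on_last_tau on_last_DeltaI contract_legs // pureM mul1r mulr1.
rewrite pure_CasI legsMl !legsZ !legsD !scaler0 !addr0.
have CD (y z : T ⊗ U) : (1 ⊗p Cas) * (y + z) = (1 ⊗p Cas) * y + (1 ⊗p Cas) * z.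
  exact: mulrDr.
rewrite !CD !pureM !mul1r !mulr1.
congr (legs _ _ _ _).
- rewrite !(pureDr, pureNr, pureZr, scalerDr).
  by rewrite [LHS](AC (2*1*1*1) ((1*3)*4*(2*5))).
- by rewrite !(pureDr, pure0r, pureZr, scalerDr) !add0r !addr0 addrA.
- rewrite !(pureDr, pureZr, scalerDr).
  by rewrite [LHS](AC (1*2*2*1) (2*4*(1*3*5*6))).
(* In the Cas coordinate, t4 from tau cancels against c (- c^-1 t4) from the counit. *)
- have c_neq0 : c != 0.
    apply: contraNneq (denominators s_neq0 s4_neq1).2 => c0.
    by rewrite -[X in _ + X](mulfV s_neq0) -mulrDr c0 mulr0.
  rewrite !pure0r add0r !pureZr pureBl pureZl scalerBr scalerA mulfV // scale1r.
  by rewrite [RHS](AC (3*2) (1*4*3*(2*5))) /= subrr addr0.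
Qed.

End Relation.

(** * The elements built slot by slot, and the relation at a hole *)

Implicit Types (f : nat -> bool) (a k : nat).

Definition leg_map (b : bool) : {lrmorphism I -> U ⊗ I} :=
  if b then (DeltaI (s:=s) : {lrmorphism I -> U ⊗ I}) else tau.

(* With f the indicator of A and a = min A, [stage f a k] is the element built
   from the part of A below k with k adjoined: across a gap one may apply tau
   repeatedly at the end instead of Delta in the middle, since
   (1 ⊗ tau) tau = (Delta ⊗ 1) tau. *)
Fixpoint stage f a k : tpow U k ⊗ I :=
  match k return tpow U k ⊗ I with
  | 0 => 1 ⊗p CasI s
  | k'.+1 =>
      if (k'.+1 <= a)%N then 1 ⊗p CasI s
      else on_last (leg_map (f k')) (stage f a k')
  end.

Lemma stage_start f a k : (k <= a)%N -> stage f a k = 1 ⊗p CasI s.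
Proof. by case: k => //= k ->. Qed.

Lemma stageS f a k : (a <= k)%N ->
  stage f a k.+1 = on_last (leg_map (f k)) (stage f a k).
Proof. by rewrite /= ltnNge => ->. Qed.

Lemma eq_stage f f' a n : (forall k, (a <= k < n)%N -> f k = f' k) ->
  stage f a n = stage f' a n.
Proof.
elim: n => // n IHn ff'; have [na|an] := leqP n.+1 a.
  by rewrite !stage_start.
rewrite ltnS in an; rewrite !stageS // ff' ?an ?ltnSn // IHn // => k /andP[ak kn].
by rewrite ff' // ak ltnS ltnW.
Qed.

(** Both Delta and tau preserve W, so the identities proved in coordinates apply to every stage. *)
Lemma stage_legs f a k : exists t1 t2 t3 t4, stage f a k = legs t1 t2 t3 t4.
Proof.
have start n : exists t1 t2 t3 t4 : tpow U n, 1 ⊗p CasI s = legs t1 t2 t3 t4.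
  by exists 0, 0, 0, 1; rewrite pure_CasI.
elim: k => [|k [t1 [t2 [t3 [t4 E]]]]]; first exact: start.
have [ka|ak] := leqP k.+1 a; first by rewrite stage_start //; exact: start.
rewrite stageS // E; case: (f k).
- by rewrite [on_last _ _]on_last_DeltaI; do 4!eexists.
- by rewrite [on_last _ _]on_last_tau; do 4!eexists.
Qed.

(* This is Gamma_A in k slots once k > max A, since eps absorbs the trailing
   applications of tau: (1 ⊗ eps) tau = eps(.) 1. *)
Definition contracted f a k : tpow U k :=
  contract (counitI (s:=s)) (stage f a k).

(** The counit undoes the Delta applied at slot k. *)
Lemma contractedS_in f a k : (a <= k)%N -> f k ->
  contracted f a k.+1 =
  ((idfun : {lrmorphism tpow U k -> tpow U k}) ⊗m incl (s:=s)) (stage f a k).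
Proof.
move=> ak fk; rewrite /contracted stageS // fk.
have [t1 [t2 [t3 [t4 ->]]]] := stage_legs f a k.
exact: contract_on_last_DeltaI.
Qed.

Lemma contractedS_notin f a k : (a <= k)%N -> ~~ f k ->
  contracted f a k.+1 = contracted f a k ⊗p 1.
Proof.
move=> ak /negbTE fk; rewrite /contracted stageS // fk.
have [t1 [t2 [t3 [t4 ->]]]] := stage_legs f a k.
exact: contract_on_last_tau.
Qed.

Lemma on_last_pure1 (A B C D : algType F) (g : {lrmorphism B -> C ⊗ D}) (t : A) :
  on_last g (t ⊗p 1) = t ⊗p 1 ⊗p 1.
Proof. by rewrite /on_last /= tmapE /= rmorph1 -pure1 tassocE. Qed.

Section Hole.
Variables (f : nat -> bool) (a h : nat).
Hypotheses (ah : (a < h)%N) (fh : ~~ f h).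

(** With f the indicator of A, these are the sets B, Y, A + h, A < h, A > h and {h} of the relation
    at the hole h. *)
Let fB k := (k < h)%N && f k || (k == h).
Let fY k := (k == h) || (h < k)%N && f k.
Let fV k := (k == h) || f k.
Let fE k := (k < h)%N && f k.
Let fD k := (h < k)%N && f k.
Let fH k := (k == h).

(** At k = h + 1 this is [q_anticomm_legs] behind the first h slots. Beyond h the sets Y, A + h and
    A > h agree with A, so one algebra morphism extends all their stages at once, while the
    contracted factors only gain a factor 1. *)
Lemma stage_relation k : (h < k)%N ->
  qanti (contracted fB a k ⊗p 1) (stage fY h k) =
  stage f a k + c *: ((contracted fH h k ⊗p 1) * stage fV a k)
    + c *: ((contracted fE a k ⊗p 1) * stage fD h.+1 k).
Proof.
elim: k => // k IHk; rewrite ltnS leq_eqVlt => /predU1P[<-{k IHk}|hk].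
  have ah' := ltnW ah.
  have fBh : fB h by rewrite /fB eqxx orbT.
  have fVh : fV h by rewrite /fV eqxx.
  have fYh : fY h by rewrite /fY eqxx.
  have fHh : fH h by rewrite /fH eqxx.
  have fEh : ~~ fE h by rewrite /fE ltnn.
  have below g : (forall j, (j < h)%N -> g j = f j) ->
      stage g a h = stage f a h.
    by move=> gf; apply: eq_stage => j /andP[_ /gf].
  rewrite (contractedS_in ah' fBh) (contractedS_in (leqnn h) fHh).
  rewrite (contractedS_notin ah' fEh) /contracted.
  (* The part above h starts at slot h + 1, so its first stage supplies the term 1 ⊗ Cas of
     [q_anticomm_legs]. *)
  rewrite (@stage_start fD h.+1 h.+1) // !stageS // fYh fVh (negbTE fh).
  rewrite !below => [|j jh|j jh|j jh]; last 3 first.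
  - by rewrite /fE jh.
  - by rewrite /fV (ltn_eqF jh).
  - by rewrite /fB jh (ltn_eqF jh) orbF.
  rewrite !(@stage_start _ h h) //.
  have [t1 [t2 [t3 [t4 ->]]]] := stage_legs f a h.
  by rewrite [in RHS]tmapE; exact: q_anticomm_legs.
have hk' := ltnW hk; have ak : (a <= k)%N by exact: leq_trans (ltnW ah) hk'.
have kh : (k == h) = false by rewrite gtn_eqF.
have outB : ~~ fB k by rewrite /fB kh ltnNge hk'.
have outE : ~~ fE k by rewrite /fE ltnNge hk'.
have outH : ~~ fH k by rewrite /fH kh.
have fYk : fY k = f k by rewrite /fY kh hk.
have fVk : fV k = f k by rewrite /fV kh.
have fDk : fD k = f k by rewrite /fD hk.
rewrite !contractedS_notin // !stageS // fYk fVk fDk.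
have := congr1 (on_last (leg_map (f k))) (IHk hk).
by rewrite /q_anticomm !raddfD /= !linearZ /= !rmorphM /= !on_last_pure1.
Qed.

(** Contraction with the counit is an algebra morphism sending x ⊗ 1 to x. *)
Lemma contracted_relation k : (h < k)%N ->
  qanti (contracted fB a k) (contracted fY h k) =
  contracted f a k + c *: (contracted fH h k * contracted fV a k)
    + c *: (contracted fE a k * contracted fD h.+1 k).
Proof.
move=> hk; have := congr1 (contract (counitI (s:=s))) (stage_relation hk).
rewrite /q_anticomm !raddfD /= !linearZ /= !rmorphM /= !contractE.
by rewrite rmorph1 !scale1r.
Qed.

End Hole.
End Coaction.

(** * Minimum and maximum of a set of slots *)

Section SetBounds.
Variables (n : nat) (A : {set 'I_n}).

Lemma in_natE (i : 'I_n) : in_nat A i = (i \in A).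
Proof.
apply/existsP/idP => [[j /andP[jA /eqP/val_inj <-]] //|iA].
by exists i; rewrite iA eqxx.
Qed.

Lemma in_natP k : reflect (exists2 i : 'I_n, i \in A & i = k :> nat) (in_nat A k).
Proof.
apply: (iffP existsP) => [[i /andP[iA /eqP ik]]|[i iA ik]]; exists i => //.
by rewrite iA ik eqxx.
Qed.

Lemma set_min_le i : i \in A -> (set_min A <= i)%N.
Proof.
by move=> iA; exact: (Order.TotalTheory.bigmin_le_cond n (@nat_of_ord n) iA).
Qed.

Lemma set_max_ge i : i \in A -> (i <= set_max A)%N.
Proof. by move=> iA; rewrite /set_max (bigD1 i) //= leq_maxl. Qed.

Lemma set_min_in : A != finset.set0 -> in_nat A (set_min A).
Proof.
case/set0Pn => i0 i0A; case: (arg_minnP (fun i : 'I_n => val i) i0A) => i iA imin.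
apply/in_natP; exists i => //; apply/eqP; rewrite eqn_leq set_min_le // andbT.
(* The default value n of the minimum does no harm, since i < n. *)
apply: (@Order.POrderTheory.le_bigmin _ nat _ _ (@nat_of_ord n) n i) => //.
exact: ltnW.
Qed.

Lemma set_max_in : A != finset.set0 -> in_nat A (set_max A).
Proof.
case/set0Pn => i0 i0A; case: (arg_maxnP (fun i : 'I_n => val i) i0A) => i iA imax.
apply/in_natP; exists i => //; apply/eqP; rewrite eqn_leq set_max_ge //.
exact/bigmax_leqP.
Qed.

End SetBounds.

Lemma set_min_eq n (A : {set 'I_n}) a :
  in_nat A a -> (forall k, in_nat A k -> (a <= k)%N) -> set_min A = a.
Proof.
move=> aA amin; have A0 : A != finset.set0.
  by have /in_natP[i iA _] := aA; apply/set0Pn; exists i.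
apply/eqP; rewrite eqn_leq amin ?set_min_in // andbT.
by have /in_natP[i iA <-] := aA; exact: set_min_le.
Qed.

(** * Identification of the contracted stages with Gamma_A *)

Section GammaStage.
Variables (F : fieldType) (s : F).
Hypotheses (s_neq0 : s != 0) (s4_neq1 : s ^+ 4 != 1).
Local Notation U := (osp s).
Local Notation I := (coideal s).
Variable tau : {lrmorphism I -> U ⊗ I}.
Hypothesis htau : is_coaction tau.
Variables (n : nat) (A : {set 'I_n}).
Hypothesis A_neq0 : A != finset.set0.
Let a := set_min A.
Let f := in_nat A.

(* A state whose last position is not in A is already the stage of the next
   position. *)
Definition stage_state (b : bool) k : state s b k :=
  match b return state s b k with
  | true => stage tau f a k
  | false => stage tau f a k.+1
  end.

(** Induction from min A through the four cases of [step]; only two consecutive slots outside A need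
    more than unfolding the stages. *)
Lemma Gamma_state_stage k : (a <= k)%N ->
  Gamma_state tau A k = stage_state (in_nat A k) k.
Proof.
have start (b : bool) k' : b -> (k' <= a)%N ->
    1 ⊗p CasI s = stage_state b k' :> state s b k'.
  by case: b => // _ k'a; rewrite /= stage_start.
elim: k => [|k IHk] ak.
  have a0 : a = 0%N by apply/eqP; rewrite -leqn0.
  by apply: start; rewrite // -a0; exact: set_min_in.
have [ka|ka] := leqP k.+1 a.
  have a_eq : k.+1 = a by apply/eqP; rewrite eqn_leq ka.
  rewrite /= ka; apply: start => //.
  by rewrite [k.+1]a_eq; exact: set_min_in.
have Gk : Gamma_state tau A k.+1 = step tau (in_nat A k.+1) (Gamma_state tau A k).
  by rewrite /= -/a leqNgt ka.
rewrite Gk IHk //.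
have := @stageS _ _ tau f a k; rewrite -/f.
have := @stageS _ _ tau f a k.+1 ak; rewrite -/f.
have [t1 [t2 [t3 [t4 E]]]] := stage_legs htau f a k.
rewrite ltnS in ka => S1 /(_ ka) S0.
have := on_last_tau_tau s_neq0 htau t1 t2 t3 t4.
rewrite -E.
move: S0 S1; case: (f k); case: (f k.+1) => S0 S1 co.
- exact: esym S0.
- by apply: etrans (esym S1); rewrite S0.
- by [].
(* Both slots lie outside A: [step] applies Delta in the middle, the stage applies tau at the end,
   and [co] equates the two. *)
- apply: etrans (esym S1); apply: etrans (congr1 _ S0) _; rewrite S0.
  exact: esym co.
Qed.

(** At max A the counit axiom recovers the included state; each later slot lies outside A and
    contributes a factor 1, as in [Gamma_pad]. *)
Lemma Gamma_contracted : Gamma tau A = contracted tau f a n.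
Proof.
rewrite /Gamma (negbTE A_neq0).
have max_lt : (set_max A < n)%N.
  by have /in_natP[i _ <-] := set_max_in A_neq0.
have amax : (a <= set_max A)%N.
  by have /in_natP[i iA <-] := set_max_in A_neq0; exact: set_min_le.
suff pad m : (set_max A < m)%N -> Gamma_pad tau A m = contracted tau f a m.
  exact: pad.
elim: m => // k IHk.
have -> : Gamma_pad tau A k.+1 =
    (if k == set_max A then state_incl (Gamma_state tau A k)
     else Gamma_pad tau A k ⊗p 1) by [].
rewrite ltnS leq_eqVlt => /predU1P[k_max|k_max].
  have ak : (a <= k)%N by rewrite -k_max.
  have fk : f k by rewrite -k_max; exact: set_max_in.
  rewrite k_max eqxx Gamma_state_stage // contractedS_in // -/f.
  by case: (f k) fk.
have kNmax : k == set_max A = false by rewrite gtn_eqF.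
rewrite kNmax IHk // contractedS_notin //; first exact: leq_trans (ltnW k_max).
apply/in_natP => -[i iA ik]; move: k_max.
by rewrite -ik ltnNge set_max_ge.
Qed.

End GammaStage.

(** * Induction on the number of holes *)

Section Generation.
Variables (F : fieldType) (s : F).
Hypotheses (s_neq0 : s != 0) (s4_neq1 : s ^+ 4 != 1).
Variable tau : {lrmorphism coideal s -> osp s ⊗ coideal s}.
Hypothesis htau : is_coaction tau.
Variable n : nat.
Implicit Types (f g : nat -> bool) (a h k : nat).

Definition set_of f : {set 'I_n} := [set i : 'I_n | f i].

Lemma in_nat_set_of f k : (k < n)%N -> in_nat (set_of f) k = f k.
Proof. by move=> kn; rewrite (in_natE _ (Ordinal kn)) inE. Qed.

Lemma set_of_in_nat (A : {set 'I_n}) : set_of (in_nat A) = A.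
Proof. by apply/setP => i; rewrite inE in_natE. Qed.

Lemma Gamma_set_of f a : (a < n)%N -> f a ->
  (forall k, (k < n)%N -> f k -> (a <= k)%N) ->
  Gamma tau (set_of f) = contracted tau f a n.
Proof.
move=> an fa amin.
have fA : in_nat (set_of f) a by rewrite in_nat_set_of.
have A_neq0 : set_of f != finset.set0.
  by have /in_natP[i iA _] := fA; apply/set0Pn; exists i.
rewrite (Gamma_contracted s_neq0 s4_neq1 htau) //.
have -> : set_min (set_of f) = a.
  apply: set_min_eq => // k /[dup] /in_natP[i _ ik]; rewrite -ik in_nat_set_of //.
  exact: amin.
by congr contract; apply: eq_stage => k /andP[_ kn]; rewrite in_nat_set_of.
Qed.

Definition holes f : {set 'I_n} := [set k : 'I_n | [&& ~~ f k,
  [exists i : 'I_n, (i < k)%N && f i] & [exists j : 'I_n, (k < j)%N && f j]]].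

Lemma holesP f (k : 'I_n) : reflect
  [/\ ~~ f k, exists2 i : 'I_n, (i < k)%N & f i
    & exists2 j : 'I_n, (k < j)%N & f j] (k \in holes f).
Proof.
rewrite inE; apply: (iffP and3P) => -[fk H1 H2]; split=> //.
- by have /existsP[i /andP[]] := H1; exists i.
- by have /existsP[i /andP[]] := H2; exists i.
- by apply/existsP; have [i ik fi] := H1; exists i; rewrite ik.
- by apply/existsP; have [i ik fi] := H2; exists i; rewrite ik.
Qed.

(** The conditions make every hole of g a hole of f other than h, so the inclusion of the sets of
    holes is strict. *)
Lemma card_holes_lt f g (h : 'I_n) : h \in holes f ->
  (forall k, g k -> f k || (k == h :> nat)) ->
  (forall i j k, (i < k < j)%N -> g i -> g j -> ~~ g k ->
     ~~ f k && (k != h :> nat)) ->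
  (#|holes g| < #|holes f|)%N.
Proof.
move=> hf gf gk; apply: proper_card; apply/properP; split; last first.
  exists h => //; apply/holesP => -[gh [i ih gi] [j hj gj]].
  have /= := gk i j h; rewrite ih hj gi gj gh eqxx andbF => /(_ isT isT isT isT).
  by [].
apply/fintype.subsetP => k /holesP[gNk [i ik gi] [j kj gj]].
have /andP[fNk kh] : ~~ f k && (k != h :> nat) by apply: (gk i j); rewrite ?ik.
(* If the element of g on one side of k is h itself, an element of f beyond h takes its place. *)
have [_ [i0 i0h fi0] [j0 hj0 fj0]] := holesP _ _ hf.
apply/holesP; split=> //.
- have /orP[fi|/eqP ih] := gf _ gi; first by exists i.
  by exists i0; rewrite // (ltn_trans i0h) // -ih.
- have /orP[fj|/eqP jh] := gf _ gj; first by exists j.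
  by exists j0; rewrite // (ltn_trans _ hj0) // -jh.
Qed.

Lemma no_holes_interval f (i0 : 'I_n) : holes f = finset.set0 -> f i0 ->
  exists i j : 'I_n, (i <= j)%N /\ set_of f = Defs.interval i j.
Proof.
move=> f0 fi0.
case: (arg_minnP (P := fun i : 'I_n => f i) (fun i : 'I_n => val i) fi0).
move=> i fi imin.
case: (arg_maxnP (P := fun i : 'I_n => f i) (fun i : 'I_n => val i) fi0).
move=> j fj jmax.
exists i, j; split; first exact: imin.
apply/setP => k; rewrite !inE; apply/idP/andP => [fk|[ik kj]].
  by split; [exact: imin | exact: jmax].
apply: contraT => fNk; suff : k \in holes f by rewrite f0 inE.
apply/holesP; split=> //.
- exists i => //; rewrite ltn_neqAle ik andbT.
  by apply: contraNneq fNk => /val_inj <-.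
- exists j => //; rewrite ltn_neqAle kj andbT.
  by apply: contraNneq fNk => /val_inj ->.
Qed.

Local Open Scope classical_set_scope.

Lemma gen_subalg_closed (A : algType F) (X : set A) :
  [/\ forall x y, gen_subalg X x -> gen_subalg X y -> gen_subalg X (x + y),
      forall (a : F) x, gen_subalg X x -> gen_subalg X (a *: x),
      forall x y, gen_subalg X x -> gen_subalg X y -> gen_subalg X (x * y)
    & gen_subalg X 1].
Proof.
have [S1 SL SM] := (is_subalgP _).1 (gen_subalg_is_subalg X).
have SD x y : gen_subalg X x -> gen_subalg X y -> gen_subalg X (x + y).
  by move=> Sx Sy; rewrite -[x]scale1r; exact: SL.
have S0 : gen_subalg X 0 by rewrite -(addNr 1) -scaleN1r; exact: SL.
split=> // a x Sx; rewrite -[_ *: _]addr0; exact: SL.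
Qed.

Local Notation S := (gen_subalg (interval_Gammas tau n)).

Lemma Gamma_hole f (h : 'I_n) : h \in holes f ->
    (forall k : 'I_n, k \in holes f -> (k <= h)%N) ->
    (forall g, (#|holes g| < #|holes f|)%N -> S (Gamma tau (set_of g))) ->
  S (Gamma tau (set_of f)).
Proof.
move=> hf hmax IH.
have [fNh [i ih fi] [j hj fj]] := holesP _ _ hf.
have h1n : (h.+1 < n)%N by exact: leq_ltn_trans hj (ltn_ord j).
(* Since h is the largest hole and some element lies above it, h + 1 belongs to the set. *)
have fh1 : f h.+1.
  apply: contraT => fNh1; suff /hmax : Ordinal h1n \in holes f by rewrite ltnn.
  apply/holesP; split=> //; first by exists i => //; exact: ltnW.
  exists j => //; rewrite ltn_neqAle hj andbT.
  by apply: contraNneq fNh1 => /= ->.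
have /ex_minnP[a fa amin] : exists a, f a by exists i.
have ah : (a < h)%N by exact: leq_ltn_trans (amin _ fi) ih.
have an : (a < n)%N by exact: ltn_trans ah _.
have := contracted_relation s_neq0 s4_neq1 htau ah fNh (ltn_ord h).
(* Each contracted element must start at the minimum of its set: a for A, B, A + h and A < h; h for
   Y and {h}; h + 1 for A > h, by [fh1]. *)
rewrite -!(@Gamma_set_of _ a) -?(@Gamma_set_of _ h) -?(@Gamma_set_of _ h.+1) //;
  last 12 first.
- by rewrite ltnSn.
- by move=> k _ /andP[].
- by move=> k _ /eqP ->.
- by rewrite eqxx.
- by move=> k _ /predU1P[->//|/andP[/ltnW]].
- by rewrite ah.
- by move=> k _ /andP[_ /amin].
- by rewrite fa orbT.
- by move=> k _ /predU1P[->|/amin //]; exact: ltnW.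
- by move=> k _ /amin.
- by rewrite ah fa.
- by move=> k _ /orP[/andP[_ /amin //]|/eqP ->]; exact: ltnW.
(* The relation is solved for Gamma_A. *)
rewrite -addrA => /esym /(canRL (addrK _)) ->.
have [SD SZ SM _] := gen_subalg_closed (interval_Gammas tau n).
have fewer g (gf : forall k, g k -> f k || (k == h :> nat))
    (gk : forall i j k, (i < k < j)%N -> g i -> g j -> ~~ g k ->
       ~~ f k && (k != h :> nat)) : S (Gamma tau (set_of g)).
  by apply: IH; exact: card_holes_lt hf gf gk.
rewrite -scaleN1r /q_anticomm.
(* Four products remain, two from the q-anticommutator and two correction terms; [lia] checks the
   conditions of [fewer] for each factor. *)
apply: (SD); [apply: (SD) | apply: (SZ); apply: (SD)];
  apply: SZ; apply: SM; apply: fewer => [k|i1 j1 k]; clear; lia.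
Qed.

(** Removing the largest hole expresses Gamma_A through sets with fewer holes; the recursion ends at
    intervals and the empty set. *)
Lemma Gamma_in_interval_alg (A : {set 'I_n}) : S (Gamma tau A).
Proof.
have [SD SZ SM S1] := gen_subalg_closed (interval_Gammas tau n).
rewrite -(set_of_in_nat A); move: (in_nat A) => {A} f.
have [m] := ubnP #|holes f|; elim: m f => // m IHm f; rewrite ltnS => fm.
have [f0|[k0 k0f]] := set_0Vmem (holes f).
  have [A0|[i fi]] := set_0Vmem (set_of f).
    (* For the empty set the element is a scalar, which lies in any unital subalgebra. *)
    by rewrite A0 /Gamma eqxx; exact: SZ.
  rewrite inE in fi.
  have [j [k [jk ->]]] := no_holes_interval f0 fi.
  by apply: sub_gen_smallest; exists j, k.
case: (arg_maxnP (P := fun i : 'I_n => i \in holes f) (fun i : 'I_n => val i) k0f).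
move=> h hf hmax; apply: (Gamma_hole hf) => // g gf.
by apply: IHm; exact: leq_trans gf fm.
Qed.

End Generation.

Theorem corollary1 (R : realType) (q s : R[i]) (hq0 : q != 0)
    (hq1 : `|q| != 1) (hs : s ^+ 2 = q)
    (tau : {lrmorphism coideal s -> osp s ⊗ coideal s})
    (htau : is_coaction tau) (n : nat) (hn : (3 <= n)%N) :
  gen_subalg (interval_Gammas tau n) = higher_rank_alg tau n.
Proof.
have s_neq0 : s != 0 by move: hq0; rewrite -hs expf_eq0.
have s4_neq1 : s ^+ 4 != 1.
  (* Here s^4 = q^2, and q^2 = 1 would force |q| = 1. *)
  apply: contraNneq hq1 => s4; rewrite -(@pexpr_eq1 _ _ 2) // -normrX -hs.
  by rewrite -exprM s4 normr1.
rewrite eqEsubset; split.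
  apply: smallest_sub; first exact: gen_subalg_is_subalg.
  move=> _ [i [j [_ ->]]]; apply: sub_gen_smallest.
  by exists (Defs.interval i j).
apply: smallest_sub; first exact: gen_subalg_is_subalg.
move=> _ [A _ <-]; exact: Gamma_in_interval_alg.
Qed.
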